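(* Let $M$ be a smooth, Hausdorff, second countable, connected manifold of dimension $m$. Let $p,q,k,\ell\ge 0$ be integers with $(p,k)\neq(q,\ell)$, and assume $m\ge \sup(p,q)$ and $m\ge \inf\{p+2,q+3\}$. Then the $\mathrm{Vect}(M)$-modules $({\cal D}_p^k,L)$ and $({\cal D}_q^\ell,L)$ are not isomorphic; that is, there is no bijective linear map $T:{\cal D}_p^k\to{\cal D}_q^\ell$ such that $L_X\circ T=T\circ L_X$ for all $X\in \mathrm{Vect}(M)$.
   Context: $\mathrm{Vect}(M)$ is the Lie algebra of smooth vector fields of $M$, $\Omega^p(M)$ the space of smooth differential $p$-forms, $N=C^\infty(M)$. ${\cal D}_p^k$ is the space of linear differential operators of order $\le k$ from $\Omega^p(M)$ into $C^\infty(M)$. It is a $\mathrm{Vect}(M)$-module under the Lie derivative $L_XD=L_X\circ D-D\circ L_X$ ($X\in \mathrm{Vect}(M)$, $D\in{\cal D}_p^k$), where on the right-hand side $L_X$ denotes the usual Lie derivative of functions and of $p$-forms respectively. *)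

(* Defs.v *)
From HB Require Import structures.
From mathcomp Require Import all_boot all_order all_algebra.
From mathcomp Require Import ring.
From mathcomp Require Import all_classical all_reals all_analysis.

Set Implicit Arguments.
Unset Strict Implicit.
Unset Printing Implicit Defensive.

Import Order.TTheory GRing.Theory Num.Theory.
Import numFieldNormedType.Exports.

Local Open Scope classical_set_scope.
Local Open Scope ring_scope.

Section SmoothEuclidean.
Context {R : realType} {m : nat}.
Implicit Types (U : set 'rV[R]_m) (f g : 'rV[R]_m -> R).

Definition partial (i : 'I_m) f : 'rV[R]_m -> R :=
  fun x => 'D_(delta_mx 0 i) f x.

(* f is of class C^n on U (meant for U open) *)
Fixpoint class_C (n : nat) U f : Prop :=
  {in U, continuous f} /\
  if n is n'.+1 then
    forall i : 'I_m,
      {in U, forall x, derivable f x (delta_mx 0 i)} /\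
      class_C n' U (partial i f)
  else True.

Definition smooth_on U f : Prop := forall n, class_C n U f.

Lemma eq_class_C n U f g : open U -> {in U, f =1 g} ->
  class_C n U f -> class_C n U g.
Proof.
move=> oU; have cont f' g' : {in U, f' =1 g'} -> {in U, continuous f'} ->
    {in U, continuous g'}.
  move=> fg cf x xU; rewrite /continuous_at -(fg x xU).
  have nfg : \near x, f' x = g' x.
    by apply: (open_in_nearW oU) xU => y /fg.
  apply: cvg_trans (cf x xU); exact: (@near_eq_cvg _ _ (nbhs x) _ _ _ nfg).
elim: n f g => [|n IHn] f g fg /= [cf df]; split; [exact: cont fg cf|by []|
  exact: cont fg cf|] => i; case: (df i) => dfi Cfi.
have nfg x : x \in U -> \near x, f x = g x.
  by move=> xU; apply: (open_in_nearW oU) xU => y /fg.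
split=> [x xU|]; first exact: near_eq_derivable (nfg x xU) (dfi x xU).
by apply: IHn Cfi => x xU; rewrite /partial; exact/near_eq_derive/nfg.
Qed.

Lemma class_CW n U f : class_C n.+1 U f -> class_C n U f.
Proof.
elim: n f => [|n IHn] f [cf df]; first by split.
by split=> // i; have [dfi Cfi] := df i; split=> //; exact: IHn.
Qed.

Lemma class_C_cst n U (c : R) : class_C n U (cst c).
Proof.
have cc a : {in U, continuous (cst a : 'rV[R]_m -> R)}.
  by move=> x _; exact: cst_continuous.
elim: n c => [|n IHn] c; split=> // i; split=> [x _|]; first exact: derivable_cst.
suff -> : partial i (cst c) = cst 0 by exact: IHn.
by apply/funext => x; rewrite /partial derive_cst.
Qed.

Lemma class_CD n U f g : open U -> class_C n U f -> class_C n U g ->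
  class_C n U (f + g).
Proof.
move=> oU; elim: n f g => [|n IHn] f g [cf df] [cg dg]; split=> //.
- by move=> x xU; apply: continuousD; [exact: cf|exact: cg].
- by move=> x xU; apply: continuousD; [exact: cf|exact: cg].
move=> i; have [dfi Cfi] := df i; have [dgi Cgi] := dg i; split.
  by move=> x xU; apply: derivableD; [exact: dfi|exact: dgi].
apply: eq_class_C oU _ (IHn _ _ Cfi Cgi) => x xU.
by rewrite /partial deriveD//; [exact: dfi|exact: dgi].
Qed.

Lemma class_CM n U f g : open U -> class_C n U f -> class_C n U g ->
  class_C n U (f * g).
Proof.
move=> oU; elim: n f g => [|n IHn] f g Cf Cg;
    have [cf df] := Cf; have [cg dg] := Cg; split=> //.
- by move=> x xU; apply: continuousM; [exact: cf|exact: cg].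
- by move=> x xU; apply: continuousM; [exact: cf|exact: cg].
move=> i; have [dfi Cfi] := df i; have [dgi Cgi] := dg i; split.
  by move=> x xU; apply: derivableM; [exact: dfi|exact: dgi].
have := class_CD oU (IHn _ _ (class_CW Cf) Cgi) (IHn _ _ (class_CW Cg) Cfi).
apply: eq_class_C oU _ => x xU.
by rewrite /partial deriveM//; [exact: dfi|exact: dgi].
Qed.

End SmoothEuclidean.

Record chart (R : realType) (m : nat) (T : topologicalType) := Chart {
  chart_dom : set T;
  chart_map :> T -> 'rV[R]_m;
  chart_inv : 'rV[R]_m -> T;
  chart_dom_open : open chart_dom;
  chart_img_open : open (chart_map @` chart_dom);
  chart_mapK : {in chart_dom, cancel chart_map chart_inv};
  chart_map_cont : {in chart_dom, continuous chart_map};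
  chart_inv_cont : {in chart_map @` chart_dom, continuous chart_inv} }.

(* The atlas need not be maximal: smoothness of functions is the same for an
   atlas and for the maximal atlas containing it. *)
Record smooth_manifold (R : realType) (m : nat) := SmoothManifold {
  manifold_space :> topologicalType;
  atlas : set (chart R m manifold_space);
  atlas_cover : forall x, exists2 c, atlas c & chart_dom c x;
  atlas_compat : forall c d, atlas c -> atlas d -> forall i : 'I_m,
    smooth_on (c @` (chart_dom c `&` chart_dom d))
              (fun y => d (chart_inv c y) 0 i) }.

Lemma fct_lincombE (R : pzRingType) (T : Type) (V : lmodType R) (a : R)
  (F G : T -> V) x : (a *: F + G) x = a *: F x + G x.
Proof. by []. Qed.

Lemma fct0E (T : Type) (V : zmodType) (x : T) : (0 : T -> V) x = 0.
Proof. by []. Qed.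

Section Manifold.
Context {R : realType} {m : nat}.
Variable M : smooth_manifold R m.

Definition smooth_fun : {pred (M -> R)} := fun f =>
  `[< forall c, atlas c -> smooth_on (c @` chart_dom c) (f \o chart_inv c) >].

Fact smooth_fun_cst (a : R) : cst a \in smooth_fun.
Proof. by apply/asboolP => c _ n; exact: class_C_cst. Qed.

Fact smooth_fun_add f g : f \in smooth_fun -> g \in smooth_fun ->
  f + g \in smooth_fun.
Proof.
move=> /asboolP sf /asboolP sg; apply/asboolP => c ac n.
by apply: class_CD (sf c ac n) (sg c ac n); exact: chart_img_open.
Qed.

Fact smooth_fun_mul f g : f \in smooth_fun -> g \in smooth_fun ->
  f * g \in smooth_fun.
Proof.
move=> /asboolP sf /asboolP sg; apply/asboolP => c ac n.
by apply: class_CM (sf c ac n) (sg c ac n); exact: chart_img_open.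
Qed.

Fact smooth_fun_opp f : f \in smooth_fun -> - f \in smooth_fun.
Proof.
have -> : - f = cst (-1) * f by apply/funext => x; rewrite fctE /= mulN1r.
by move=> sf; apply: smooth_fun_mul => //; exact: smooth_fun_cst.
Qed.

Fact smooth_fun_subring : subring_closed smooth_fun.
Proof.
split; first exact: smooth_fun_cst; last exact: smooth_fun_mul.
by move=> f g sf sg; apply/smooth_fun_add => //; exact: smooth_fun_opp.
Qed.

HB.instance Definition _ :=
  GRing.isSubringClosed.Build (M -> R) smooth_fun smooth_fun_subring.

Fact smooth_fun_scale : GRing.scaler_closed smooth_fun.
Proof.
move=> a f sf; have -> : a *: f = cst a * f by apply/funext.
by apply: smooth_fun_mul => //; exact: smooth_fun_cst.
Qed.

HB.instance Definition _ :=
  GRing.isScaleClosed.Build R (M -> R) smooth_fun smooth_fun_scale.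

(* N = C^oo(M) *)
Record Cinf := MkCinf { Cinf_val :> M -> R; _ : Cinf_val \in smooth_fun }.

HB.instance Definition _ := [isSub for Cinf_val].
HB.instance Definition _ := [Choice of Cinf by <:].
HB.instance Definition _ :=
  GRing.SubChoice_isSubComPzRing.Build _ _ Cinf (subringClosedP _).
HB.instance Definition _ := [SubZmodule_isSubLmodule of Cinf by <:].
Implicit Types f g : Cinf.

Fact Cinf_scaleAl (a : R) f g : a *: (f * g) = (a *: f) * g.
Proof. by apply: val_inj; apply/funext => x; exact: mulrA. Qed.

Fact Cinf_scaleAr (a : R) f g : a *: (f * g) = f * (a *: g).
Proof. by rewrite mulrC Cinf_scaleAl mulrC. Qed.

(* A smooth vector field is identified with the derivation of C^oo(M) that it
   defines; the value X f is the Lie derivative L_X f. *)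
Definition derivation : {pred (Cinf -> Cinf)} := fun X =>
  `[< linear X /\ forall f g, X (f * g) = X f * g + f * X g >].

Fact derivation_submod : submod_closed derivation.
Proof.
split=> [|a X Y /asboolP[lX dX] /asboolP[lY dY]]; apply/asboolP; split.
- by move=> a f g; rewrite !fct0E scaler0 addr0.
- by move=> f g; rewrite !fct0E mul0r mulr0 addr0.
- move=> b f g; rewrite !fct_lincombE lX lY !scalerDr !scalerA mulrC.
  by rewrite -!addrA; congr (_ + _); rewrite addrCA.
- move=> f g; rewrite !fct_lincombE dX dY scalerDr Cinf_scaleAl Cinf_scaleAr mulrDl mulrDr.
  by rewrite -!addrA; congr (_ + _); rewrite addrCA.
Qed.

HB.instance Definition _ :=
  GRing.isSubmodClosed.Build R (Cinf -> Cinf) derivation derivation_submod.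

Record vfield := MkVfield {
  vfield_val :> Cinf -> Cinf; _ : vfield_val \in derivation }.

HB.instance Definition _ := [isSub for vfield_val].
HB.instance Definition _ := [Choice of vfield by <:].
HB.instance Definition _ := [SubChoice_isSubLmodule of vfield by <:].
Implicit Types X Y : vfield.

Lemma vfieldP X : linear X.
Proof. by have /asboolP[] := valP X. Qed.

HB.instance Definition _ X := GRing.isLinear.Build R Cinf Cinf _ X (vfieldP X).

Lemma vfieldM X f g : X (f * g) = X f * g + f * X g.
Proof. by have /asboolP[] := valP X. Qed.

Fact vscale_subproof f X : (fun g => f * X g) \in derivation.
Proof.
apply/asboolP; split=> [a g h|g h].
  by rewrite linearP mulrDr Cinf_scaleAr.
by rewrite vfieldM mulrDr !mulrA [f * g]mulrC.
Qed.

Definition vscale f X : vfield := MkVfield (vscale_subproof f X).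

Fact vbracket_subproof X Y : (fun f => X (Y f) - Y (X f)) \in derivation.
Proof.
apply/asboolP; split=> [a f g|f g].
  by rewrite !vfieldP scalerBr opprD addrACA.
by rewrite !vfieldM !raddfD /= !vfieldM; ring.
Qed.

Definition vbracket X Y : vfield := MkVfield (vbracket_subproof X Y).

Lemma vfield_inj X Y : (forall f, X f = Y f) -> X = Y.
Proof. by move=> XY; apply: val_inj; apply/funext. Qed.

Lemma vscale1 X : vscale 1 X = X.
Proof. by apply: vfield_inj => f /=; rewrite mul1r. Qed.

Lemma vfieldD X Y f : (X + Y) f = X f + Y f.
Proof. by []. Qed.

Lemma vscaleE f X g : vscale f X g = f * X g.
Proof. by []. Qed.

Lemma vbracketE X Y f : vbracket X Y f = X (Y f) - Y (X f).
Proof. by []. Qed.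

Lemma vbracket_lin X f Y Z : vbracket X (vscale f Y + Z) =
  vscale (X f) Y + (vscale f (vbracket X Y) + vbracket X Z).
Proof.
apply: vfield_inj => g.
rewrite !vbracketE !vfieldD !vscaleE !vbracketE.
by rewrite raddfD /= vfieldM; ring.
Qed.

Section Forms.
Variable p : nat.
Implicit Types (Ys : 'I_p -> vfield) (i j : 'I_p).

Definition upd Ys i X : 'I_p -> vfield := fun j => if j == i then X else Ys j.

Lemma upd_same Ys i X Y : upd (upd Ys i X) i Y = upd Ys i Y.
Proof. by apply/funext => j; rewrite /upd; case: eqP. Qed.

Lemma updC Ys i j X Y : i != j ->
  upd (upd Ys i X) j Y = upd (upd Ys j Y) i X.
Proof.
move=> ij; apply/funext => l; rewrite /upd.
by have [->|//] := eqVneq l j; rewrite eq_sym (negbTE ij).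
Qed.

Lemma upd_id Ys i : upd Ys i (Ys i) = Ys.
Proof. by apply/funext => j; rewrite /upd; case: eqP => [->|]. Qed.

(* A p-form is identified with the alternating C^oo(M)-multilinear map that
   it induces on p-tuples of vector fields. *)
Definition alt_multilinear : {pred (('I_p -> vfield) -> Cinf)} := fun w =>
  `[< (forall Ys i f X Y, w (upd Ys i (vscale f X + Y)) =
         f * w (upd Ys i X) + w (upd Ys i Y)) /\
      (forall Ys i j, i != j -> Ys i = Ys j -> w Ys = 0) >].

Fact alt_multilinear_submod : submod_closed alt_multilinear.
Proof.
split=> [|a v w /asboolP[lv av] /asboolP[lw aw]]; apply/asboolP; split.
- by move=> Ys i f X Y; rewrite !fct0E mulr0 addr0.
- by [].
- move=> Ys i f X Y; rewrite !fct_lincombE lv lw scalerDr Cinf_scaleAr mulrDr.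
  by rewrite addrACA.
- by move=> Ys i j ij Yij; rewrite fct_lincombE (av _ _ _ ij Yij)
    (aw _ _ _ ij Yij) scaler0 addr0.
Qed.

HB.instance Definition _ :=
  GRing.isSubmodClosed.Build R (('I_p -> vfield) -> Cinf) alt_multilinear
    alt_multilinear_submod.

Record form := MkForm {
  form_val :> ('I_p -> vfield) -> Cinf; _ : form_val \in alt_multilinear }.

HB.instance Definition _ := [isSub for form_val].
HB.instance Definition _ := [Choice of form by <:].
HB.instance Definition _ := [SubChoice_isSubLmodule of form by <:].
Implicit Types v w : form.

Lemma form_inj v w : (forall Ys, v Ys = w Ys) -> v = w.
Proof. by move=> vw; apply: val_inj; apply/funext. Qed.

Lemma form_lincombE a v w Ys : (a *: v + w) Ys = a *: v Ys + w Ys.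
Proof. by []. Qed.

Lemma formD v w Ys : (v + w) Ys = v Ys + w Ys.
Proof. by []. Qed.

Lemma form_lin w Ys i f X Y : w (upd Ys i (vscale f X + Y)) =
  f * w (upd Ys i X) + w (upd Ys i Y).
Proof. by have /asboolP[] := valP w. Qed.

Lemma form_alt w Ys i j : i != j -> Ys i = Ys j -> w Ys = 0.
Proof. by have /asboolP[_] := valP w; exact. Qed.

Lemma form_add w Ys i X Y : w (upd Ys i (X + Y)) =
  w (upd Ys i X) + w (upd Ys i Y).
Proof. by rewrite -[X in LHS]vscale1 form_lin mul1r. Qed.

Lemma form_antisym w Ys i j X Y : i != j ->
  w (upd (upd Ys i X) j Y) + w (upd (upd Ys i Y) j X) = 0.
Proof.
move=> ij; have alt0 Z : w (upd (upd Ys i Z) j Z) = 0.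
  by apply: (form_alt w ij); rewrite /upd !eqxx (negbTE ij).
have := alt0 (X + Y); rewrite form_add !(updC _ _ _ ij) !form_add.
by rewrite -!(updC _ _ _ ij) !alt0 add0r addr0 addrC.
Qed.

Fact fscale_subproof f w : (fun Ys => f * w Ys) \in alt_multilinear.
Proof.
apply/asboolP; split=> [Ys i g X Y|Ys i j ij Yij].
  by rewrite form_lin; ring.
by rewrite (form_alt w ij Yij) mulr0.
Qed.

Definition fscale f w : form := MkForm (fscale_subproof f w).

Fact lie_form_subproof X w :
  (fun Ys => X (w Ys) - \sum_i w (upd Ys i (vbracket X (Ys i))))
    \in alt_multilinear.
Proof.
apply/asboolP; split=> [Ys i f Y Z|Ys i j ij Yij].
  have term l : w (upd (upd Ys i (vscale f Y + Z)) l
                    (vbracket X (upd Ys i (vscale f Y + Z) l))) =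
      (if l == i then X f * w (upd Ys i Y) else 0) +
      (f * w (upd (upd Ys i Y) l (vbracket X (upd Ys i Y l))) +
       w (upd (upd Ys i Z) l (vbracket X (upd Ys i Z l)))).
    have [->|li] := eqVneq l i.
      by rewrite !upd_same /upd eqxx vbracket_lin -!/(upd _ _ _) !form_lin.
    have il : i != l by rewrite eq_sym.
    by rewrite add0r !(updC _ _ _ il) form_lin /upd !(negbTE li).
  rewrite (eq_bigr _ (fun l _ => term l)) !big_split /= -big_mkcond big_pred1_eq.
  rewrite -mulr_sumr form_lin raddfD /= vfieldM; ring.
rewrite (form_alt w ij Yij) raddf0 sub0r (bigD1 i)//= (bigD1 j) 1?eq_sym//=.
rewrite big1 ?addr0 => [|l /andP[li lj]]; last first.
  by apply: (form_alt w ij); rewrite /upd [i == l]eq_sym [j == l]eq_sym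
    (negbTE li) (negbTE lj).
set Z := vbracket X (Ys i).
have <- : Z = vbracket X (Ys j) by rewrite /Z Yij.
apply/eqP; rewrite oppr_eq0; apply/eqP.
have := form_antisym w Ys Z (Ys i) ij.
by rewrite {1}Yij upd_id {1}(updC _ _ _ ij) upd_id.
Qed.

(* (L_X w)(Y_1,..,Y_p) = X(w(Y_1,..,Y_p)) - \sum_i w(Y_1,..,[X,Y_i],..,Y_p) *)
Definition lie_form X w : form := MkForm (lie_form_subproof X w).

Lemma fscaleE f w Ys : fscale f w Ys = f * w Ys.
Proof. by []. Qed.

Lemma lie_formE X w Ys : lie_form X w Ys =
  X (w Ys) - \sum_i w (upd Ys i (vbracket X (Ys i))).
Proof. by []. Qed.

Lemma lie_form_linear X : linear (lie_form X).
Proof.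
move=> a v w; apply: form_inj => Ys.
rewrite form_lincombE !lie_formE form_lincombE vfieldP scalerBr addrACA -opprD.
by rewrite scaler_sumr -big_split.
Qed.

Lemma lie_form_scale X f w :
  lie_form X (fscale f w) = fscale (X f) w + fscale f (lie_form X w).
Proof.
apply: form_inj => Ys.
rewrite formD !fscaleE !lie_formE fscaleE vfieldM.
under eq_bigr do rewrite fscaleE.
by rewrite -mulr_sumr; ring.
Qed.

Definition commutator (D : form -> Cinf) f : form -> Cinf :=
  fun w => D (fscale f w) - f * D w.

(* Linear differential operators from the C^oo(M)-module of p-forms to C^oo(M):
   order <= 0 means C^oo(M)-linear, order <= k+1 means that all the commutators
   with multiplications by functions have order <= k. *)
Fixpoint order_le (k : nat) (D : form -> Cinf) : Prop :=
  if k is k'.+1 then forall f, order_le k' (commutator D f)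
  else forall f w, D (fscale f w) = f * D w.

Definition differential_operator k : {pred (form -> Cinf)} := fun D =>
  `[< linear D /\ order_le k D >].

Lemma order_le_lincomb k a D E : order_le k D -> order_le k E ->
  order_le k (a *: D + E).
Proof.
elim: k D E => [|k IHk] D E oD oE /= f.
  by move=> w; rewrite !fct_lincombE oD oE mulrDr Cinf_scaleAr.
have -> : commutator (a *: D + E) f = a *: commutator D f + commutator E f.
  apply/funext => w; rewrite /commutator !fct_lincombE scalerBr mulrDr.
  by rewrite -Cinf_scaleAr opprD addrACA.
by apply: IHk; [exact: oD|exact: oE].
Qed.

Lemma order_le0 k : order_le k (0 : form -> Cinf).
Proof.
elim: k => [|k IHk] f /=; first by move=> w; rewrite !fct0E mulr0.
rewrite (_ : commutator 0 f = 0)//; apply/funext => w.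
by rewrite /commutator !fct0E mulr0 subr0.
Qed.

Fact differential_operator_submod k : submod_closed (differential_operator k).
Proof.
split=> [|a D E /asboolP[lD oD] /asboolP[lE oE]]; apply/asboolP; split.
- by move=> a v w; rewrite !fct0E scaler0 addr0.
- exact: order_le0.
- move=> b v w; rewrite !fct_lincombE lD lE !scalerDr !scalerA mulrC.
  by rewrite addrACA.
- exact: order_le_lincomb.
Qed.

HB.instance Definition _ k :=
  GRing.isSubmodClosed.Build R (form -> Cinf) (differential_operator k)
    (differential_operator_submod k).

(* D_p^k *)
Record diffop k := MkDiffop {
  diffop_val :> form -> Cinf; _ : diffop_val \in differential_operator k }.

HB.instance Definition _ k := [isSub for @diffop_val k].
HB.instance Definition _ k := [Choice of diffop k by <:].
HB.instance Definition _ k := [SubChoice_isSubLmodule of diffop k by <:].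

Lemma lie_order_le k X (D : form -> Cinf) : linear D -> order_le k D ->
  order_le k (fun w => X (D w) - D (lie_form X w)).
Proof.
elim: k D => [|k IHk] D lD oD.
  move=> f w; have DD u v : D (u + v) = D u + D v.
    by have := lD 1 u v; rewrite !scale1r.
  by rewrite lie_form_scale DD !oD vfieldM; ring.
move=> f /=; have DD u v : D (u + v) = D u + D v.
  by have := lD 1 u v; rewrite !scale1r.
rewrite (_ : commutator _ f = - 1 *: commutator D (X f) +
    (fun w => X (commutator D f w) - commutator D f (lie_form X w))).
  apply: order_le_lincomb; first exact: oD.
  apply: IHk; last exact: oD.
  have fscale_lin a v w : fscale f (a *: v + w) = a *: fscale f v + fscale f w.
    apply: form_inj => Ys.
    by rewrite form_lincombE !fscaleE form_lincombE mulrDr Cinf_scaleAr.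
  move=> a v w; rewrite /commutator fscale_lin !lD mulrDr -Cinf_scaleAr.
  by rewrite opprD addrACA scalerBr.
apply/funext => w; rewrite fct_lincombE scaleN1r /commutator lie_form_scale DD.
by rewrite (raddfB X) /= vfieldM; ring.
Qed.

Fact lie_op_subproof k X (D : diffop k) :
  (fun w => X (D w) - D (lie_form X w)) \in differential_operator k.
Proof.
have /asboolP[lD oD] := valP D; apply/asboolP; split; last exact: lie_order_le.
move=> a v w; rewrite lie_form_linear !lD vfieldP scalerBr.
by rewrite opprD addrACA.
Qed.

(* L_X D = L_X \o D - D \o L_X *)
Definition lie_op k X (D : diffop k) : diffop k := MkDiffop (lie_op_subproof X D).

End Forms.
End Manifold.

(* Main.v *)
From HB Require Import structures.
From mathcomp Require Import all_boot all_order all_algebra.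
From mathcomp Require Import perm ring lra.
From mathcomp Require Import all_classical all_reals all_analysis.
Require Import Defs.

(** A Vect(M)-equivariant map need not be local a priori, but it preserves the
    operators of the form L_Y D with Y supported in a coordinate domain U, and
    these are supported in the closure of U.  On operators supported in U one
    can use polynomial vector fields in coordinates x_i as if they were global.
    Writing e = [., x_i], b D = - D o L_{d_i}, L D = L_{d_i} D and
    P D = D o (dx_i /\ i_{d_i}), the Casimir element of the copy of sl_2 spanned
    by d_i, x_i d_i, x_i^2 d_i acts as - 2 N (N + 1) + 2 k L, where N = P - b e
    is a degree operator with eigenvalues j_i in the natural numbers and k lowers
    the order.  For D in D_p^k, the joint eigenvalues (j_1, .., j_m) are the
    multi-indices alpha + 1_I with |alpha| <= k and |I| = p.  Hence p is the
    minimal number of nonzero j_i, and the maximum of j_1 is k + [p > 0]; these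
    two facts separate the modules. *)

Set Implicit Arguments.
Unset Strict Implicit.
Unset Printing Implicit Defensive.

Import Order.TTheory GRing.Theory Num.Theory.
Import numFieldNormedType.Exports.

Local Open Scope classical_set_scope.
Local Open Scope ring_scope.

(** * Smooth functions on R^m *)

(** The degree operators [N] are built from [e], [b] and [P], which are not Lie derivatives, so an
    equivariant [T] need not commute with them. It does commute with the Casimir operators, and
    these see [N] only through [N (N + 1)], which is injective on natural numbers. The term [k L]
    does not vanish, so the degrees are eigenvalues only modulo operators of lower order; every
    spectral argument is therefore an induction on the order, ending at the zero operator. The other
    obstacle is the support. Nothing is known about the support of [T D], even when [D] is supported
    in a small set; but [T (L_Y D) = L_Y (T D)] is controlled by the support of [Y]. Hence the test
    operators are taken of the form [L_{d_i} F], and two nested neighbourhoods are used: [F] lives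
    in the smaller one, where the cutoff of [Y] is 1 and [Y] acts as [d_i], while [L_Y (T D)] lives
    in the larger one. Both sets carry the same coordinates, so the same Casimir operators are read
    on either side. *)

Section LineDerivative.
Context {R : realType} {V : normedModType R}.
Implicit Types (f : V -> R) (v z : V) (s : R).

Lemma line_growth f v z s :
  (fun h : R => h^-1 *: ((fun t : R => f (t *: v + z)) (h *: 1 + s) -
     (fun t : R => f (t *: v + z)) s)) =
  (fun h => h^-1 *: (f (h *: v + (s *: v + z)) - f (s *: v + z))).
Proof. by apply/funext => h; rewrite addrA -scalerDl [h *: 1]mulr1. Qed.

Lemma is_derive_line f v z s d :
  is_derive (s *: v + z) v f d -> is_derive s 1 (fun t : R => f (t *: v + z)) d.
Proof.
case=> df <-; split; last by rewrite /derive line_growth.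
by move: df; rewrite /derivable line_growth.
Qed.

(** The mean value theorem in the form of a remainder estimate. Differentiability of C^1 functions,
    Lipschitz bounds and differentiation under the integral sign all rest on it. *)
Lemma MVT_affine_bound (phi dphi : R -> R) (b c e : R) :
  (forall s, `|s| <= `|b| -> is_derive s 1 phi (dphi s)) ->
  (forall s, `|s| <= `|b| -> `|dphi s - c| <= e) ->
  `|phi b - phi 0 - c * b| <= e * `|b|.
Proof.
move=> dphiP dphie.
have key x y : x <= y -> (forall s, x <= s <= y -> `|s| <= `|b|) ->
    `|phi y - phi x - c * (y - x)| <= e * (y - x).
  move=> xy sb.
  have [s /itvP s01||s /itvP s01 ->] := @MVT_segment R phi dphi x y xy.
  - by apply: dphiP; apply: sb; rewrite !s01.
  - apply: derivable_within_continuous => s; rewrite in_itv /= => s01.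
    by have [] := dphiP s (sb s s01).
  rewrite -mulrBl normrM (ger0_norm (_ : 0 <= y - x)) ?subr_ge0//.
  by apply: ler_wpM2r; rewrite ?subr_ge0// dphie// sb// !s01.
have [b0|b0] := leP 0 b.
  have := key 0 b b0; rewrite subr0 (ger0_norm b0); apply=> s /andP[s0 sb].
  by rewrite ger0_norm.
have := key b 0 (ltW b0); rewrite sub0r (ltr0_norm b0).
rewrite (_ : phi 0 - phi b - c * - b = - (phi b - phi 0 - c * b)); last by ring.
rewrite normrN; apply=> s /andP[bs s0].
by rewrite ler0_norm// lerN2.
Qed.

End LineDerivative.

Section SmoothCalculus.
Context {R : realType}.
Implicit Types m n : nat.

Lemma class_C_sub m n (U V : set 'rV[R]_m) f : V `<=` U -> class_C n U f -> class_C n V f.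
Proof.
move=> VU; have inVU x : x \in V -> x \in U by rewrite !inE; exact: VU.
elim: n f => [|n IHn] f /= [cf df]; split=> //.
- by move=> x /inVU/cf.
- by move=> x /inVU/cf.
move=> i; have [dfi Cfi] := df i; split; last exact: IHn.
by move=> x /inVU/dfi.
Qed.

(** [class_C] tests continuity and partial derivatives in the ambient space at each point of the
    set, so it is a pointwise condition and any [V] through the point will do. *)
Lemma class_C_local m n (U : set 'rV[R]_m) f :
  (forall x, U x -> exists2 V, V x & class_C n V f) -> class_C n U f.
Proof.
elim: n f => [|n IHn] f loc /=; split=> //.
- move=> x /set_mem Ux; have [V Vx [cf _]] := loc x Ux.
  by apply: cf; rewrite inE.
- move=> x /set_mem Ux; have [V Vx [cf _]] := loc x Ux.
  by apply: cf; rewrite inE.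
- move=> i; split.
    move=> x /set_mem Ux; have [V Vx [_ df]] := loc x Ux.
    by have [dfi _] := df i; apply: dfi; rewrite inE.
  apply: IHn => x Ux; have [V Vx [_ df]] := loc x Ux.
  by exists V => //; have [] := df i.
Qed.

Lemma continuous_bigsum {T : topologicalType} (I : Type) (r : seq I)
    (F : I -> T -> R) (x : T) :
  (forall i, {for x, continuous (F i)}) ->
  {for x, continuous (fun y => \sum_(i <- r) F i y)}.
Proof.
move=> cF; elim: r => [|i r IHr].
  have -> : (fun y => \sum_(i <- [::]) F i y) = cst 0.
    by apply/funext => y; rewrite big_nil.
  exact: cst_continuous.
have -> : (fun y => \sum_(j <- i :: r) F j y) = F i + (fun y => \sum_(j <- r) F j y).
  by apply/funext => y; rewrite big_cons.
exact: continuousD.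
Qed.

Lemma entry_norm_le m (h : 'rV[R]_m) i : `|h 0 i| <= `|h|.
Proof. by rewrite [leRHS]/Num.norm /= mx_normrE; exact: (le_bigmax _ _ (0, i)). Qed.

Lemma row_norm_le m (h : 'rV[R]_m) (r : R) : 0 <= r ->
  (forall i, `|h 0 i| <= r) -> `|h| <= r.
Proof.
move=> r0 hr; rewrite [leLHS]/Num.norm /= mx_normrE; apply: bigmax_le => //= -[i j] _.
by rewrite ord1.
Qed.

Lemma differentiable_approx (V W : normedModType R) (f : V -> W)
    (df : {linear V -> W}) x : continuous df ->
  (forall e : R, 0 < e -> \forall h \near (0 : V), `|f (h + x) - f x - df h| <= e * `|h|) ->
  differentiable f x.
Proof.
move=> cdf fdf.
have exp : f \o shift x = cst (f x) + df +o_ 0 id.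
  apply/eqaddoP => e e0; apply: filterS (fdf e e0) => h.
  by rewrite -addrA -opprD.
by apply/diff_locallyP; rewrite (diff_unique cdf exp); split.
Qed.

Lemma C1_differentiable m (U : set 'rV[R]_m) f x : open U -> U x -> class_C 1 U f ->
  differentiable f x.
Proof.
move=> oU Ux [_ Cf].
pose df (h : 'rV[R]_m) := \sum_i h 0 i * partial i f x.
have ldf : linear df.
  move=> a u v; rewrite /df scaler_sumr -big_split; apply: eq_bigr => i _ /=.
  by rewrite !mxE mulrDl -mulrA.
pose dfL : {linear 'rV[R]_m -> R} :=
  HB.pack df (GRing.isLinear.Build _ _ _ _ _ ldf).
have cdf : continuous dfL.
  move=> h; apply: continuous_bigsum => i.
  apply: (@continuousM _ _ (fun y : 'rV[R]_m => y 0 i) (cst (partial i f x))).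
    exact: coord_continuous.
  exact: cst_continuous.
apply: (differentiable_approx cdf) => _/posnumP[e].
have e0 : 0 < e%:num / m.+1%:R by rewrite divr_gt0.
have : \forall y \near x, U y /\ forall i, `|partial i f y - partial i f x| <= e%:num / m.+1%:R.
  near=> y; split.
    by near: y; exact: open_nbhs_nbhs.
  near: y; apply: filter_forall => i.
  have [_ [cpi _]] := Cf i.
  have /cpi/cvgrPdist_le/(_ _ e0) : x \in U by rewrite inE.
  by apply: filterS => y; rewrite distrC.
move=> /nbhs_ballP[d /= d0 xd].
near=> h.
have hd : `|h| < d.
  by near: h; apply/nbhs_ballP; exists d => // z; rewrite -ball_normE /= sub0r normrN.
(* The points [x + hk k] join [x] to [x + h] along segments parallel to the axes, and the mean value
   theorem is applied on each. The [m] errors add up to at most [e]; dividing by [m.+1] also covers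
   [m = 0]. *)
pose hk k : 'rV[R]_m := \row_i (if (i < k)%N then h 0 i else 0).
have tele k : (k <= m)%N ->
  `|f (x + hk k) - f x - \sum_(i < m | (i < k)%N) h 0 i * partial i f x| <=
   k%:R * (e%:num / m.+1%:R * `|h|).
  elim: k => [_|k IHk km].
    rewrite big_pred0// (_ : hk 0%N = 0) ?addr0 ?subrr ?subr0 ?normr0 ?mul0r//.
    by apply/rowP => i; rewrite !mxE.
  pose i := Ordinal km.
  have hkE : hk k.+1 = h 0 i *: delta_mx 0 i + hk k.
    apply/rowP => j; rewrite !mxE eqxx /= ltnS leq_eqVlt.
    have [->|ji] := eqVneq j i; first by rewrite /= eqxx ltnn mulr1 addr0.
    by rewrite mulr0 add0r (_ : (_ == _) = false)//; apply: contra_neqF ji => /eqP ji;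
      exact/val_inj.
  have := @MVT_affine_bound _ (fun t => f (t *: delta_mx 0 i + (x + hk k)))
    (fun t => partial i f (t *: delta_mx 0 i + (x + hk k))) (h 0 i) (partial i f x)
    (e%:num / m.+1%:R).
  have near_seg s : `|s| <= `|h 0 i| -> ball x d (s *: delta_mx 0 i + (x + hk k)).
    move=> sh; rewrite -ball_normE /= addrCA opprD addrA subrr sub0r normrN.
    apply: le_lt_trans hd; apply: row_norm_le => // j.
    rewrite !mxE eqxx /=; have [->|ji] := eqVneq j i.
      by rewrite ltnn addr0 mulr1 (le_trans sh)// entry_norm_le.
    rewrite mulr0 add0r; case: ifP => _; last by rewrite normr0.
    exact: entry_norm_le.
  have : forall s : R, `|s| <= `|h 0 i| ->
    is_derive s 1 (fun t => f (t *: delta_mx 0 i + (x + hk k)))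
       (partial i f (s *: delta_mx 0 i + (x + hk k))).
    move=> s /near_seg/xd[Us _]; apply: is_derive_line; apply: derivableP.
    by have [+ _] := Cf i; apply; rewrite inE.
  move=> H /(_ H) {H}.
  have : forall s : R, `|s| <= `|h 0 i| ->
   `|partial i f (s *: delta_mx 0 i + (x + hk k)) - partial i f x| <= e%:num / m.+1%:R.
    by move=> s /near_seg/xd[_ +]; exact.
  move=> H /(_ H) {H}.
  rewrite scale0r add0r => Hi.
  rewrite (bigD1 i)//= hkE.
  rewrite (eq_bigl (fun j : 'I_m => (j < k)%N)); last first.
    move=> j; rewrite ltnS leq_eqVlt -val_eqE /=.
    by case: eqP => [->|] //=; rewrite ?ltnn ?andbT.
  rewrite -[k.+1%:R]natr1 mulrDl mul1r [leRHS]addrC.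
  set A := f _; set B := h 0 i * _; set S := \sum_(_ < m | _) _.
  rewrite (_ : A - f x - (B + S) = (A - f (x + hk k) - B) + (f (x + hk k) - f x - S)); last by ring.
  apply: le_trans (ler_normD _ _) _; apply: lerD; last by apply: IHk; exact: ltnW.
  move: Hi; rewrite /A /B mulrC addrCA => /le_trans; apply.
  by apply: ler_wpM2l; [rewrite ltW|exact: entry_norm_le].
have := tele m (leqnn m).
rewrite (_ : hk m = h); last by apply/rowP => i; rewrite !mxE ltn_ord.
rewrite (eq_bigl xpredT); last by move=> i; rewrite ltn_ord.
rewrite /= [h + x]addrC => /le_trans; apply.
rewrite mulrA; apply: ler_wpM2r => //.
rewrite mulrCA ger_pMr//; rewrite ler_pdivrMr// mul1r ler_nat.
exact: leqnSn.
Unshelve. all: by end_near. Qed.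

End SmoothCalculus.

Section SmoothComposition.
Context {R : realType}.

Lemma diff_row m (f : 'rV[R]_m -> R) x h : differentiable f x ->
  'd f x h = \sum_i h 0 i * partial i f x.
Proof.
move=> df; rewrite {1}[h]row_sum_delta linear_sum; apply: eq_bigr => i _.
by rewrite linearZ /partial deriveE.
Qed.

Lemma derive_line (U W : normedModType R) (f : U -> W) (x v : U) :
  'D_v f x = 'D_1 (fun h : R => f (h *: v + x)) 0.
Proof.
rewrite /derive; set g1 := fun h => h^-1 *: _; set g2 := fun h => h^-1 *: _.
suff -> : g1 = g2 by [].
by rewrite funeqE /g1 /g2 => h /=; rewrite addr0 scale0r add0r [_%:A]mulr1.
Qed.

(** Only a directional derivative of [g] is given; restricted to the line through [x], [g] becomes
    differentiable in one variable and the chain rule for differentials applies. *)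
Lemma is_derive_comp_diff (U V W : normedModType R) (f : V -> W) (g : U -> V) (x v : U) (dg : V) :
  differentiable f (g x) -> is_derive x v g dg ->
  is_derive x v (f \o g) ('d f (g x) dg).
Proof.
move=> df [/derivable1P/derivable1_diffP dgx <-].
have g0 : g (0 *: v + x) = g x by rewrite scale0r add0r.
have dfg : differentiable (f \o (fun h : R => g (h *: v + x))) 0.
  by apply: differentiable_comp => //; rewrite g0.
have E : 'D_v g x = 'd (fun h : R => g (h *: v + x)) 0 1.
  by rewrite -deriveE// -derive_line.
split; first by apply/derivable1P/derivable1_diffP.
have -> : 'D_v (f \o g) x = 'd (f \o (fun h : R => g (h *: v + x))) 0 1.
  by rewrite -deriveE// (derive_line (f \o g)).
by rewrite diff_comp//= ?g0// E.
Qed.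

Lemma continuous_row m (T : topologicalType) (g : T -> 'rV[R]_m) x :
  (forall i, {for x, continuous (fun y => g y 0 i)}) -> {for x, continuous g}.
Proof.
move=> cg; apply/cvgrPdist_le => /= e e0.
near=> y; apply: row_norm_le; first exact: ltW.
move=> i; rewrite !mxE; move: i; near: y; apply: filter_forall => i.
by have /cvgrPdist_le/(_ _ e0) := cg i.
Unshelve. all: by end_near. Qed.

Lemma class_C_sum m n (U : set 'rV[R]_m) (I : Type) (r : seq I) (F : I -> 'rV[R]_m -> R) :
  open U -> (forall i, class_C n U (F i)) ->
  class_C n U (fun x => \sum_(i <- r) F i x).
Proof.
move=> oU CF; elim: r => [|i r IHr].
  apply: (eq_class_C oU _ (class_C_cst n U 0)) => x _.
  by rewrite big_nil.
apply: (eq_class_C oU _ (class_CD oU (CF i) IHr)) => x _.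
by rewrite big_cons.
Qed.

Lemma class_C_le m n k (U : set 'rV[R]_m) f : (k <= n)%N -> class_C n U f -> class_C k U f.
Proof.
elim: n => [|n IHn]; first by rewrite leqn0 => /eqP ->.
by rewrite leq_eqVlt => /predU1P[->//|kn] /class_CW; exact: IHn.
Qed.

Lemma class_C_comp m l n (U : set 'rV[R]_m) (V : set 'rV[R]_l) f
    (g : 'rV[R]_l -> 'rV[R]_m) :
  open U -> open V -> (forall y, V y -> U (g y)) -> class_C n U f ->
  (forall j, class_C n V (fun y => g y 0 j)) -> class_C n V (f \o g).
Proof.
move=> oU oV VU.
elim: n f => [|n IHn] f Cf Cg; have cfg : {in V, continuous (f \o g)}.
- move=> y yV; apply: continuous_comp.
    by apply: continuous_row => i; have [+ _] := Cg i; apply.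
  by have [+ _] := Cf; apply; rewrite inE; apply: VU; exact: set_mem.
- by split.
- move=> y yV; apply: continuous_comp.
    by apply: continuous_row => i; have [+ _] := Cg i; apply.
  by have [+ _] := Cf; apply; rewrite inE; apply: VU; exact: set_mem.
split=> // i.
have dfg y : y \in V -> is_derive y (delta_mx 0 i : 'rV[R]_l) (f \o g)
    (\sum_j partial i (fun z => g z 0 j) y * partial j f (g y)).
  move=> yV; have Vy := set_mem yV.
  have df : differentiable f (g y).
    by apply: (C1_differentiable oU (VU _ Vy)); apply: class_C_le Cf.
  have dg : derivable g y (delta_mx 0 i).
    apply/derivable_mxP => a j; rewrite ord1.
    by have [_ /(_ i)[+ _]] := Cg j; apply.
  have := is_derive_comp_diff df (derivableP dg).
  rewrite diff_row// derive_mx//.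
  under eq_bigr do rewrite mxE.
  by [].
split; first by move=> y /dfg[].
apply: (@eq_class_C _ _ _ _
  (fun y => \sum_j partial i (fun z => g z 0 j) y * (partial j f \o g) y)) => //.
  by move=> y yV; have [_ <-] := dfg y yV.
apply: class_C_sum => // j; apply: class_CM => //.
  by have [_ /(_ i)[]] := Cg j.
apply: IHn; last by move=> k; apply: class_CW.
by have [_ /(_ j)[]] := Cf.
Qed.

Lemma class_C_inv m n (U : set 'rV[R]_m) f : open U -> (forall x, U x -> f x != 0) ->
  class_C n U f -> class_C n U (fun x => (f x)^-1).
Proof.
move=> oU f0.
elim: n => [|n IHn] Cf.
  split=> // x xU; apply: (@continuousV _ _ f); first by apply: f0; exact: set_mem.
  by have [+ _] := Cf; apply.
have [cf df] := Cf.
split=> [x xU|i].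
  by apply: (@continuousV _ _ f); [apply: f0; exact: set_mem|exact: cf].
have [dfi Cfi] := df i; split.
  by move=> x xU; apply: derivableV; [exact/f0/set_mem|exact: dfi].
have Cn := IHn (class_CW Cf).
have := class_CM oU (class_CM oU (class_C_cst n U (-1)) (class_CM oU Cn Cn)) Cfi.
apply: eq_class_C oU _ => x xU.
rewrite /partial deriveV; [|exact/f0/set_mem|exact: dfi].
by rewrite !fctE /= mulN1r expr2 invfM.
Qed.

(** Smoothness of [phi] is encoded by a class [P] of functions closed under differentiation, which
    is what the induction on [n] consumes. The class in view is that of all [flat p]. *)
Lemma class_C_comp1 m n (P : (R -> R) -> Prop) (U : set 'rV[R]_m) phi g :
  (forall phi, P phi -> exists2 psi, P psi & forall s : R, is_derive s 1 phi (psi s)) ->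
  open U -> P phi -> class_C n U g -> class_C n U (phi \o g).
Proof.
move=> dP oU; elim: n phi => [|n IHn] phi Pphi Cg; have [psi Ppsi dphi] := dP _ Pphi;
  have cphi : continuous phi.
- by move=> s; apply/differentiable_continuous/derivable1_diffP; have [] := dphi s.
- by split=> // x xU; apply: continuous_comp; [have [+ _] := Cg; apply|exact: cphi].
- by move=> s; apply/differentiable_continuous/derivable1_diffP; have [] := dphi s.
have [cg dg] := Cg.
split=> [x xU|i]; first by apply: continuous_comp; [exact: cg|exact: cphi].
have [dgi Cgi] := dg i.
have dpg x : x \in U -> is_derive x (delta_mx 0 i : 'rV[R]_m) (phi \o g)
    (psi (g x) * partial i g x).
  move=> xU; have dpx : differentiable phi (g x).
    by apply/derivable1_diffP; have [] := dphi (g x).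
  have := is_derive_comp_diff dpx (derivableP (dgi x xU)).
  rewrite -[X in 'd _ _ X]mulr1 -[X in 'd _ _ X]/(_ *: _) linearZ /= -deriveE//.
  by have [_ ->] := dphi (g x); rewrite [_ *: _]mulrC.
split; first by move=> x /dpg[].
apply: eq_class_C oU _ (class_CM oU (IHn _ Ppsi (class_CW Cg)) Cgi) => x xU.
by rewrite {2}/partial; have [_ ->] := dpg x xU.
Qed.

End SmoothComposition.

(** * Flat functions and bump functions *)

Section Bump.
Context {R : realType}.

Lemma is_derive_quadratic (V : normedModType R) (f : V -> R) (x v : V) (d K : R) :
  (forall s, `|f (s *: v + x) - f x - s * d| <= K * s ^+ 2) -> is_derive x v f d.
Proof.
move=> fK.
have K0 : 0 <= K by have := fK 1; rewrite expr1n mulr1; apply: le_trans.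
suff H : h^-1 *: (f (h *: v + x) - f x) @[h --> 0^'] --> d.
  by split; [apply/cvg_ex; exists d|exact/cvg_lim].
apply/cvgrPdist_le => e e0; near=> h.
have h0 : h != 0 by near: h; exact: nbhs_dnbhs_neq.
have he : `|h| < e / (K + 1).
  by near: h; apply: dnbhs0_lt; rewrite divr_gt0// ltr_wpDl.
rewrite -[_ *: _]/(_ * _) -normrN opprB.
rewrite (_ : _ - d = h^-1 * (f (h *: v + x) - f x - h * d)); last first.
  by rewrite [RHS]mulrBr mulKf.
rewrite normrM normfV ler_pdivrMl ?normr_gt0//; apply: le_trans (fK h) _.
rewrite -real_normK ?num_real// expr2 mulrA mulrC ler_wpM2l//.
move/ltW: he; rewrite ler_pdivlMr ?ltr_wpDl// mulrDr mulr1 mulrC; apply: le_trans.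
by rewrite lerDl.
Unshelve. all: by end_near. Qed.

(** The polynomial factor makes the family closed under differentiation; [flat 1] is the classical
    [exp (-1/x)] extended by 0. *)
Definition flat (p : {poly R}) (x : R) : R :=
  if 0 < x then p.[x^-1] * expR (- x^-1) else 0.

Lemma poly_le_expR (p : {poly R}) :
  exists2 C : R, 0 <= C & forall u, 0 <= u -> `|p.[u]| <= C * expR u.
Proof.
exists (\sum_(i < size p) `|p`_i| * i`!%:R) => [|u u0].
  by apply: sumr_ge0 => i _; rewrite mulr_ge0.
rewrite horner_coef mulr_suml; apply: le_trans (ler_norm_sum _ _ _) _.
apply: ler_sum => i _; rewrite normrM -mulrA ler_wpM2l// ger0_norm ?exprn_ge0//.
case: (nat_of_ord i) => [|n]; first by rewrite expr0 fact0 mul1r (le_trans _ (expR_ge1Dx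
  u))// lerDl.
have := expR_ge1Dxn n u0; rewrite -ler_pdivrMl ?ltr0n ?fact_gt0// [X in X -> _]/=.
by move=> H; rewrite mulrC; apply: le_trans H; rewrite lerDr.
Qed.

Lemma flat_le (p : {poly R}) : exists2 C : R, 0 <= C & forall h, `|flat p h| <= C * `|h|.
Proof.
have [C C0 pC] := poly_le_expR ('X * p).
exists C => // h; rewrite /flat; case: ifPn => [h0|_]; last by rewrite normr0 mulr_ge0.
have hi0 : 0 <= h^-1 by rewrite invr_ge0 ltW.
have := pC _ hi0; rewrite hornerM hornerX normrM (ger0_norm hi0) => H.
rewrite normrM (ger0_norm (expR_ge0 _)) (gtr0_norm h0) expRN ler_pdivrMr ?expR_gt0//.
by rewrite mulrAC -ler_pdivrMr// mulrC.
Qed.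

Lemma is_derive_flat (p : {poly R}) (x : R) :
  is_derive x 1 (flat p) (flat ('X^2 * (p - p^`())) x).
Proof.
have [x0|x0|->] := ltgtP x 0.
- have -> : flat ('X^2 * (p - p^`())) x = 0 by rewrite /flat ltNge ltW.
  apply: (@near_eq_is_derive _ _ _ (cst (0 : R))).
  near=> y; rewrite /flat ltNge (_ : y <= 0)//; near: y.
  by apply: filterS (lt_nbhsl x0) => y /ltW.
- have nx : \forall y \near x, p.[y^-1] * expR (- y^-1) = flat p y.
    near=> y; rewrite /flat (_ : 0 < y)//; near: y; exact: lt_nbhsr.
  apply: (near_eq_is_derive nx).
  have x0' : x != 0 by rewrite gt_eqF.
  have dV : is_derive x 1 (fun y : R => y^-1) (- x ^- 2).
    split; first by apply: (@derivableV _ _ id) => //; exact: derivable_id.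
    rewrite (@deriveV _ _ id)// derive_id -[LHS]/(_ * _) mulr1//.
  have dp : is_derive x 1 (fun y : R => p.[y^-1]) (p^`().[x^-1] * - x ^- 2).
    by apply: (@is_derive1_comp _ (horner p) (fun y : R => y^-1)).
  have de : is_derive x 1 (fun y : R => expR (- y^-1)) (expR (- x^-1) * x ^- 2).
    apply: (@is_derive1_comp _ expR (fun y : R => - y^-1)); rewrite -[X in is_derive _ _ _ X]opprK.
    exact: is_deriveN.
  rewrite /flat x0.
  have := is_deriveM dp de; congr is_derive.
  rewrite hornerM hornerXn hornerD hornerN exprVn -[X in X + _]/(_ * _) -[X in _ + X]/(_ * _); ring.
- rewrite {2}/flat ltxx.
  (* The extra factor ['X] is [1/s] at [s], so the linear bound for ['X * p] is a quadratic bound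
     for [flat p] at 0. *)
  have [C C0 pC] := flat_le ('X * p).
  apply: (@is_derive_quadratic _ _ _ _ _ C) => s.
  rewrite [s *: 1]mulr1 addr0 mulr0 subr0 {2}/flat ltxx subr0.
  have := pC s; rewrite /flat; case: ifPn => [s0|_ _]; last first.
    by rewrite normr0 mulr_ge0// sqr_ge0.
  rewrite hornerM hornerX -mulrA normrM normfV (gtr0_norm s0) ler_pdivrMl//.
  by rewrite expr2 mulrCA.
Unshelve. all: by end_near. Qed.

Lemma smooth_coord m (U : set 'rV[R]_m) i : open U -> smooth_on U (fun y : 'rV[R]_m => y 0 i).
Proof.
have d j (y : 'rV[R]_m) : is_derive y (delta_mx 0 j : 'rV[R]_m)
    (fun y : 'rV[R]_m => y 0 i) (i == j)%:R.
  apply: (@is_derive_quadratic _ _ _ _ _ 0) => s.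
  by rewrite !mxE eqxx /= addrK subrr normr0 mul0r.
move=> oU [|n]; split=> //.
- by move=> y _; exact: coord_continuous.
- by move=> y _; exact: coord_continuous.
move=> j; split=> [y _|]; first by have [] := d j y.
apply: eq_class_C oU _ (class_C_cst n U (i == j)%:R) => y _.
by rewrite /partial; have [_ ->] := d j y.
Qed.

Lemma smooth_on_comp_flat m (U : set 'rV[R]_m) p g : open U -> smooth_on U g ->
  smooth_on U (flat p \o g).
Proof.
move=> oU sg n; apply: (@class_C_comp1 _ _ _ (fun f => exists p, f = flat p)) => //.
  by move=> _ [q ->]; exists (flat ('X^2 * (q - q^`()))); [eexists|exact: is_derive_flat].
by exists p.
Qed.

Lemma flat1_gt0 x : (0 < flat 1 x) = (0 < x).
Proof. by rewrite /flat; case: ifP => // _; rewrite ?ltxx// hornerC mul1r expR_gt0. Qed.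

Lemma flat1_eq0 x : x <= 0 -> flat 1 x = 0.
Proof. by rewrite /flat ltNge => ->. Qed.

Lemma flat1_ge0 x : 0 <= flat 1 x.
Proof.
by rewrite /flat; case: ifP => // _; rewrite hornerC mul1r expR_ge0.
Qed.

Lemma exists_bump m (a : 'rV[R]_m) (r : R) : 0 < r ->
  exists chi : 'rV[R]_m -> R, [/\ smooth_on setT chi,
    forall y, `|y - a| <= r -> chi y = 1 & forall y, 2 * r <= `|y - a| -> chi y = 0].
Proof.
move=> r0.
(* The norm is the sup norm, so a product of one-variable steps works: [step i] is 1 where
   [q i <= 1] and 0 where [q i >= 4], that is, at distance at least [2 * r] in coordinate [i]. *)
pose q i (y : 'rV[R]_m) := ((y 0 i - a 0 i) / r) ^+ 2.
pose den i (y : 'rV[R]_m) := flat 1 (4 - q i y) + flat 1 (q i y - 1).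
pose step i (y : 'rV[R]_m) := flat 1 (4 - q i y) * (den i y)^-1.
have den0 i y : den i y != 0.
  rewrite gt_eqF// /den; have [q1|q1] := ltP 1 (q i y).
    by rewrite ltr_wpDl ?flat1_ge0// flat1_gt0 subr_gt0.
  by rewrite ltr_wpDr ?flat1_ge0// flat1_gt0 subr_gt0 (le_lt_trans q1)// ltr1n.
have oT : open [set: 'rV[R]_m] by exact: openT.
have smq i : smooth_on setT (q i).
  move=> n; have C1 : class_C n setT (fun y : 'rV[R]_m => (y 0 i - a 0 i) / r).
    exact: (class_CM oT (class_CD oT (smooth_coord i oT n)
      (class_C_cst n setT (- a 0 i))) (class_C_cst n setT r^-1)).
  by have := class_CM oT C1 C1; apply: eq_class_C oT _ => y _; rewrite /q expr2.
have smf (c d : R) i : smooth_on setT (fun y => flat 1 (c + d * q i y)).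
  apply: (@smooth_on_comp_flat _ _ _ (fun y => c + d * q i y) oT) => n.
  exact: (class_CD oT (class_C_cst n setT c) (class_CM oT (class_C_cst n setT d) (smq i n))).
have smA i : smooth_on setT (fun y => flat 1 (4 - q i y)).
  by move=> n; apply: eq_class_C oT _ (smf 4 (-1) i n) => y _; rewrite mulN1r.
have smB i : smooth_on setT (fun y => flat 1 (q i y - 1)).
  by move=> n; apply: eq_class_C oT _ (smf (-1) 1 i n) => y _; rewrite mul1r addrC.
have sms i : smooth_on setT (step i).
  move=> n; apply: (class_CM oT (smA i n)).
  by apply: class_C_inv => //; exact: (class_CD oT (smA i n) (smB i n)).
exists (fun y => \prod_i step i y); split.
- move=> n; elim: (index_enum _) => [|i s IHs].
    by apply: eq_class_C oT _ (class_C_cst n setT 1) => y _; rewrite big_nil.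
  by apply: eq_class_C oT _ (class_CM oT (sms i n) IHs) => y _; rewrite big_cons.
- move=> y yr; apply: big1 => i _.
  have q1 : q i y <= 1.
    rewrite /q -real_normK ?num_real// expr_le1// normrM normfV (gtr0_norm r0).
    rewrite ler_pdivrMr// mul1r; apply: le_trans yr.
    by have := entry_norm_le (y - a) i; rewrite !mxE.
  have := den0 i y; rewrite /step /den (@flat1_eq0 (q i y - 1)) ?subr_le0// addr0.
  by move=> ?; rewrite divff.
- move=> y yr; have [i yi] : exists i, 2 * r <= `|(y - a) 0 i|.
    apply/existsP; apply: contraT; rewrite negb_exists => /forallP H.
    have m0 : (0 < m)%N.
      case: m a {q den step den0 oT smq smf smA smB sms} y yr H => // a y + _.
      rewrite (_ : y - a = 0) ?normr0; last by apply/rowP => -[].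
      by rewrite leNgt mulr_gt0.
    have : `|y - a| < 2 * r.
      rewrite [ltLHS]/Num.norm /= mx_normrE; apply: bigmax_lt.
        by rewrite mulr_gt0.
      by move=> [j i] _ /=; rewrite ord1 ltNge.
    by rewrite ltNge yr.
  rewrite (bigD1 i)//= /step flat1_eq0 ?mul0r// subr_le0.
  rewrite /q -real_normK ?num_real// normrM normfV (gtr0_norm r0).
  rewrite (_ : 4 = 2 ^+ 2 :> R); last by rewrite -natrX.
  rewrite lerXn2r ?nnegrE ?divr_ge0 ?(ltW r0)//.
  rewrite ler_pdivlMr//.
  by move: yi; rewrite !mxE.
Qed.

End Bump.

(** * Integrals over the unit interval *)

Section UnitIntegral.
Context {R : realType}.
Implicit Types (f g : R -> R).
Local Notation mu := (@lebesgue_measure R).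

Definition unit_int g : R := \int[mu]_(t in `[0, 1]%classic) g t.

Lemma continuous_subr f g : continuous f -> continuous g ->
  continuous (fun t => f t - g t).
Proof. by move=> cf cg t; apply: (@continuousB _ _ _ f g); [exact: cf|exact: cg]. Qed.

Lemma unit_integrable g : continuous g -> mu.-integrable `[0, 1]%classic (EFin \o g).
Proof.
move=> cg; apply: continuous_compact_integrable; first exact: segment_compact.
exact: continuous_subspaceT.
Qed.

Lemma unit_intB f g : continuous f -> continuous g ->
  unit_int (fun t => f t - g t) = unit_int f - unit_int g.
Proof. by move=> cf cg; apply: RintegralB => //; exact: unit_integrable. Qed.

Lemma unit_intD f g : continuous f -> continuous g ->
  unit_int (fun t => f t + g t) = unit_int f + unit_int g.
Proof. by move=> cf cg; apply: RintegralD => //; exact: unit_integrable. Qed.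

Lemma unit_intZ c g : continuous g -> unit_int (fun t => c * g t) = c * unit_int g.
Proof. by move=> cg; apply: RintegralZl => //; exact: unit_integrable. Qed.

Lemma unit_int_sum (I : Type) (r : seq I) (F : I -> R -> R) :
  (forall i, continuous (F i)) ->
  unit_int (fun t => \sum_(i <- r) F i t) = \sum_(i <- r) unit_int (F i).
Proof.
move=> cF; elim: r => [|i r IHr].
  rewrite big_nil (_ : (fun t => _) = (fun t : R => 0 * t)).
    by rewrite unit_intZ ?mul0r// => x; exact: cvg_id.
  by apply/funext => t; rewrite big_nil mul0r.
rewrite big_cons -IHr -unit_intD//.
  by congr unit_int; apply/funext => t; rewrite big_cons.
by move=> t; apply: continuous_bigsum => j; exact: cF.
Qed.

Lemma unit_int_le g (K : R) : continuous g -> (forall t, 0 <= t <= 1 -> `|g t| <= K) ->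
  `|unit_int g| <= K.
Proof.
move=> cg gK.
have cng : continuous (fun t => `|g t|) by move=> t; apply: cvg_norm; exact: cg.
apply: le_trans (le_normr_Rintegral _ (unit_integrable cg)) _ => //.
have cK : continuous (fun _ : R => K) by exact: cst_continuous.
apply: le_trans (le_Rintegral _ (unit_integrable cng) (unit_integrable cK) _) _ => //.
rewrite Rintegral_cst//= lebesgue_measure_itv /= lte_fin ltr01 -EFinB subr0 /= mulr1.
by [].
Qed.

Lemma unit_int_FTC F g : continuous g -> (forall t : R, is_derive t 1 F (g t)) ->
  unit_int g = F 1 - F 0.
Proof.
move=> cg dF; have cF : continuous F.
  by move=> t; apply/differentiable_continuous/derivable1_diffP; have [] := dF t.
rewrite /unit_int /Rintegral (@continuous_FTC2 _ _ F)//.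
- exact: continuous_subspaceT.
- split; first by move=> t _; have [] := dF t.
  + by apply: cvg_at_right_filter; exact: cF.
  + by apply: cvg_at_left_filter; exact: cF.
- by move=> t _; rewrite derive1E; have [_ ->] := dF t.
Qed.

End UnitIntegral.

(** * Hadamard's lemma with smooth coefficients *)

Section Hadamard.
Context {R : realType} {m : nat}.
Implicit Types (H : 'rV[R]_m -> R) (a y z : 'rV[R]_m).

Definition smooth_compact H :=
  smooth_on setT H /\ exists r : R, forall y, r < `|y| -> H y = 0.

Lemma smooth_partial (U : set 'rV[R]_m) H i : smooth_on U H -> smooth_on U (partial i H).
Proof. by move=> sH n; have [_ /(_ i)[]] := sH n.+1. Qed.

Lemma smooth_continuous (U : set 'rV[R]_m) H : smooth_on U H -> {in U, continuous H}.
Proof. by move=> sH; have [] := sH 0%N. Qed.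

Lemma smoothT_continuous H : smooth_on setT H -> continuous H.
Proof. by move=> sH y; apply: (smooth_continuous sH); rewrite inE. Qed.

Lemma smooth_differentiable (U : set 'rV[R]_m) H y :
  open U -> smooth_on U H -> U y -> differentiable H y.
Proof. by move=> oU sH Uy; apply: (C1_differentiable oU Uy); exact: sH. Qed.

Lemma open_norm_gt (r : R) : open [set y : 'rV[R]_m | r < `|y|].
Proof.
rewrite (_ : [set _ | _] = (fun y : 'rV[R]_m => `|y|) @^-1` [set x | r < x])//.
by apply: open_comp => [y _|]; [exact: norm_continuous|exact: open_gt].
Qed.

Lemma smooth_compact_partial H i : smooth_compact H -> smooth_compact (partial i H).
Proof.
move=> [sH [r Hr]]; split; first exact: smooth_partial.
exists r => y ry; rewrite /partial (near_eq_derive (g := cst (0 : R))) ?derive_cst//.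
have : nbhs y [set z : 'rV[R]_m | r < `|z|].
  by apply: open_nbhs_nbhs; split; [exact: open_norm_gt|].
by apply: filterS => z; exact: Hr.
Qed.

Lemma smooth_compact_bounded H : smooth_compact H -> exists C, forall y, `|H y| <= C.
Proof.
move=> [sH [r Hr]]; pose B := [set y : 'rV[R]_m | `|y| <= `|r|].
have cB : compact B.
  apply: bounded_closed_compact.
    by exists `|r|; split; [exact: num_real|move=> s rs y /= yr; exact: le_trans yr (ltW rs)].
  rewrite (_ : B = ~` [set y | `|r| < `|y|]).
    by apply: open_closedC; exact: open_norm_gt.
  by apply/seteqP; split=> y; rewrite /B /=; [rewrite leNgt => /negP|move/negP; rewrite -leNgt].
have cH : {within B, continuous (fun y => `|H y|)}.
  apply: continuous_subspaceT => y; apply: (@continuous_comp _ _ _ H (fun x : R => `|x|)).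
    exact: (smoothT_continuous sH).
  exact: norm_continuous.
have B0 : B !=set0 by exists 0; rewrite /B /= normr0.
have [c _ Hc] := EVT_max_rV B0 cB cH.
exists `|H c| => y; have [yr|ry] := leP `|y| `|r|; first by apply: Hc; rewrite inE.
by rewrite Hr ?normr0// (le_lt_trans _ ry)// ler_norm.
Qed.

Lemma smooth_compact_lipschitz H : smooth_compact H ->
  exists2 K, 0 <= K & forall y z, `|H y - H z| <= K * `|y - z|.
Proof.
move=> sH; have /choice[C HC] : forall i, exists C, forall y, `|partial i H y| <= C.
  by move=> i; apply: smooth_compact_bounded; exact: smooth_compact_partial.
have C0 i : 0 <= C i by apply: le_trans (HC i 0).
exists (\sum_i C i) => [|y z]; first exact: sumr_ge0.
have dH w : differentiable H w by have [s _] := sH; exact: (smooth_differentiable openT s).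
have := @MVT_affine_bound R (fun t => H (t *: (y - z) + z))
  (fun t => 'd H (t *: (y - z) + z) (y - z)) 1 0 ((\sum_i C i) * `|y - z|).
rewrite scale1r scale0r subrK add0r mul0r subr0 normr1 mulr1; apply.
  by move=> s _; apply: is_derive_line; split; [exact: diff_derivable|exact: deriveE].
move=> s _; rewrite subr0 diff_row// mulr_suml.
apply: le_trans (ler_norm_sum _ _ _) _; apply: ler_sum => i _.
by rewrite normrM mulrC; apply: ler_pM => //; exact: entry_norm_le.
Qed.

Lemma lipschitz_continuous (V : normedModType R) (f : V -> R) (K : R) :
  (forall y z : V, `|f y - f z| <= K * `|y - z|) -> continuous f.
Proof.
move=> fK y; apply/cvgrPdist_le => e e0; near=> z.
apply: le_trans (fK _ _) _.
have yz : `|y - z| < e / (`|K| + 1).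
  by near: z; apply: cvgr_dist_lt; rewrite ?divr_gt0// ltr_wpDl.
apply: le_trans (_ : (`|K| + 1) * `|y - z| <= _).
  by rewrite ler_wpM2r// (le_trans (ler_norm _))// lerDl.
by rewrite mulrC -ler_pdivlMr ?ltW// ltr_wpDl.
Unshelve. all: by end_near. Qed.

(** Differentiating in [y] brings out a factor [t]; the weight [t ^+ n] keeps the family closed
    under partial derivatives. *)
Definition radial a n H y : R :=
  unit_int (fun t => t ^+ n * H (t *: (y - a) + a)).

Lemma continuous_ray a n H y : continuous H ->
  continuous (fun t : R => t ^+ n * H (t *: (y - a) + a)).
Proof.
move=> cH t.
apply: (@continuousM _ _ (fun t : R => t ^+ n) (fun t : R => H (t *: (y - a) + a))).
  exact: exprn_continuous.
apply: (@continuous_comp _ _ _ (fun t : R => t *: (y - a) + a) H); last exact: cH.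
apply: continuousD; last exact: cst_continuous.
exact: scalel_continuous.
Qed.

Lemma continuousZ_ray a n H y c : continuous H ->
  continuous (fun t : R => c * (t ^+ n * H (t *: (y - a) + a))).
Proof.
move=> cH t.
apply: (@continuousM _ _ (cst c) (fun t : R => t ^+ n * H (t *: (y - a) + a))).
  exact: cst_continuous.
exact: continuous_ray.
Qed.

Lemma radial_lipschitz a n H : smooth_compact H ->
  exists2 K, 0 <= K & forall y z, `|radial a n H y - radial a n H z| <= K * `|y - z|.
Proof.
move=> sH; have [K K0 HK] := smooth_compact_lipschitz sH.
have cH : continuous H by apply: smoothT_continuous; case: sH.
exists K => // y z; rewrite /radial -unit_intB; try exact: continuous_ray.
apply: unit_int_le => [|t /andP[t0 t1]].
  by apply: continuous_subr; exact: continuous_ray.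
rewrite -mulrBr normrM normrX (ger0_norm t0);
  apply: le_trans (_ : `|H (t *: (y - a) + a) - H (t *: (z - a) + a)| <= _).
  by rewrite ler_piMl// exprn_ile1.
apply: le_trans (HK _ _) _; rewrite ler_wpM2l//.
rewrite opprD addrACA subrr addr0 -scalerBr opprB addrA subrK normrZ (ger0_norm t0).
by rewrite ler_piMl.
Qed.

(** Differentiation under the integral sign: [partial i H] has a global Lipschitz constant because
    [H] has compact support, so the remainder is quadratic in [s] uniformly in [t]. *)
Lemma is_derive_radial a n H y i : smooth_compact H ->
  is_derive y (delta_mx 0 i : 'rV[R]_m) (radial a n H) (radial a n.+1 (partial i H) y).
Proof.
move=> sH; have cH : continuous H by apply: smoothT_continuous; case: sH.
have sdH := smooth_compact_partial i sH.
have cdH : continuous (partial i H) by apply: smoothT_continuous; case: sdH.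
have [K K0 HK] := smooth_compact_lipschitz sdH.
apply: (@is_derive_quadratic _ _ _ _ _ _ K) => s.
rewrite /radial -unit_intZ; last exact: continuous_ray.
rewrite -unit_intB; try exact: continuous_ray.
rewrite -unit_intB; last 2 first.
- by apply: continuous_subr; exact: continuous_ray.
- exact: continuousZ_ray.
apply: unit_int_le => [|t /andP[t0 t1]].
  apply: continuous_subr; first by apply: continuous_subr; exact: continuous_ray.
  by apply: continuousZ_ray.
set w := t *: (y - a) + a.
have -> : t *: (s *: delta_mx 0 i + y - a) + a = (t * s) *: delta_mx 0 i + w.
  by rewrite -addrA scalerDr scalerA addrA.
rewrite (_ : _ - _ = t ^+ n * (H ((t * s) *: delta_mx 0 i + w) - H w - partial i H w * (t *
  s))); last first.
  by rewrite exprS; ring.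
have := @MVT_affine_bound R (fun u => H (u *: delta_mx 0 i + w))
  (fun u => partial i H (u *: delta_mx 0 i + w)) (t * s) (partial i H w) (K * `|t * s|).
rewrite scale0r add0r => MVTb.
rewrite normrM normrX (ger0_norm t0).
apply: le_trans (ler_piMl _ _) _; rewrite ?exprn_ile1//.
apply: le_trans (MVTb _ _) _.
- move=> u _; apply: is_derive_line; apply: derivableP; apply: diff_derivable.
  by have [sm _] := sH; exact: (smooth_differentiable openT sm).
- move=> u us; apply: le_trans (HK _ _) _; rewrite addrK normrZ ler_wpM2l//.
  have -> : `|delta_mx 0 i : 'rV[R]_m| = 1.
    apply/eqP; rewrite eq_le; apply/andP; split.
      by apply: row_norm_le => // j; rewrite !mxE eqxx; case: eqP => _; rewrite /= ?normr1 ?normr0.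
    by apply: le_trans (entry_norm_le _ i); rewrite mxE !eqxx normr1.
  by rewrite mulr1.
rewrite -mulrA ler_wpM2l// -expr2 real_normK ?num_real// exprMn.
by rewrite ler_piMl ?sqr_ge0// exprn_ile1.
Qed.

Lemma smooth_radial a H : smooth_compact H -> smooth_on setT (radial a 0 H).
Proof.
move=> sH k; suff : forall n, class_C k setT (radial a n H) by exact.
have cr n H' : smooth_compact H' -> continuous (radial a n H').
  move=> sH'; have [K K0 HK] := radial_lipschitz a n sH'.
  exact: (lipschitz_continuous HK).
elim: k H sH => [|k IHk] H sH n.
  by split=> // y _; exact: cr.
split=> [y _|]; first exact: cr.
move=> i; split=> [y _|]; first by have [] := is_derive_radial a n y i sH.
apply: eq_class_C openT _ (IHk _ (smooth_compact_partial i sH) n.+1) => y _.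
by rewrite {2}/partial; have [_ ->] := is_derive_radial a n y i sH.
Qed.

(** The fundamental theorem of calculus on the segment from [a] to [y]. By [smooth_radial] the
    coefficients are smooth in [y], so they can be carried to the manifold. *)
Lemma Hadamard H a y : smooth_compact H ->
  H y - H a = \sum_i (y 0 i - a 0 i) * radial a 0 (partial i H) y.
Proof.
move=> sH; have sm := sH.1.
have cd i : continuous (partial i H).
  by apply: smoothT_continuous; exact: smooth_partial.
have -> : H y - H a = H (1 *: (y - a) + a) - H (0 *: (y - a) + a).
  by rewrite scale1r subrK scale0r add0r.
pose F (t : R) := H (t *: (y - a) + a).
pose g (t : R) := \sum_i (y - a) 0 i * (t ^+ 0 * partial i H (t *: (y - a) + a)).
have cray i : continuous (fun t : R => (y - a) 0 i * (t ^+ 0 * partial i H (t *: (y - a) + a))).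
  exact: continuousZ_ray.
have cg : continuous g by move=> t; apply: continuous_bigsum => i; exact: cray.
have dF (t : R) : is_derive t 1 F (g t).
  apply: is_derive_line.
  have dH : differentiable H (t *: (y - a) + a) by exact: (smooth_differentiable openT sm).
  split; first exact: diff_derivable.
  rewrite deriveE// diff_row//; apply: eq_bigr => i _.
  by rewrite expr0 mul1r.
rewrite -/(F 1) -/(F 0) -(unit_int_FTC cg dF).
rewrite unit_int_sum//; apply: eq_bigr => i _.
by rewrite unit_intZ ?mxE//; exact: continuous_ray.
Qed.


End Hadamard.

(** * Cutoff functions and local frames on a manifold *)

Section ChartTopology.
Context {R : realType} {m : nat} {T : topologicalType}.
Variable c : chart R m T.

Lemma chart_image_open (O : set T) : open O -> open (c @` (chart_dom c `&` O)).
Proof.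
move=> oO; rewrite openE => _ [x [cx Ox] <-].
have imgx : (c @` chart_dom c) (c x) by exists x.
have n1 : nbhs (c x) (c @` chart_dom c).
  by apply: open_nbhs_nbhs; split => //; exact: chart_img_open.
have n2 : nbhs (c x) (chart_inv c @^-1` O).
  apply: (@chart_inv_cont _ _ _ c (c x)); first by rewrite inE.
  by rewrite chart_mapK ?inE//; apply: open_nbhs_nbhs.
apply: filterS (filterI n1 n2) => y [[z cz <-]] /=; rewrite chart_mapK ?inE// => Oz.
by exists z.
Qed.

Lemma chart_preimage_open (O : set 'rV[R]_m) : open O -> open (chart_dom c `&` c @^-1` O).
Proof.
move=> oO; rewrite openE => x [cx Ox]; apply: filterI.
  by apply: open_nbhs_nbhs; split => //; exact: chart_dom_open.
by apply: (@chart_map_cont _ _ _ c x); [rewrite inE|exact: open_nbhs_nbhs].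
Qed.

Lemma chart_inv_compact (K : set 'rV[R]_m) : K `<=` c @` chart_dom c -> compact K ->
  compact (chart_inv c @` K).
Proof.
move=> Kc cK; apply: continuous_compact => //; apply: continuous_in_subspaceT => y.
by rewrite inE => /Kc yc; apply: chart_inv_cont; rewrite inE.
Qed.

Definition extend0 (g : 'rV[R]_m -> R) : T -> R :=
  fun x => if x \in chart_dom c then g (c x) else 0.

Lemma extend0_in g x : chart_dom c x -> extend0 g x = g (c x).
Proof. by move=> cx; rewrite /extend0 mem_set. Qed.

Lemma extend0_out g (K : set 'rV[R]_m) x :
  (forall y, ~ K y -> g y = 0) -> ~ (chart_inv c @` K) x -> extend0 g x = 0.
Proof.
move=> gK Kx; rewrite /extend0; case: ifPn => // /set_mem cx; apply: gK => Kcx.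
by apply: Kx; exists (c x) => //; rewrite chart_mapK ?inE.
Qed.

End ChartTopology.

Lemma closed_ball_compact {R : realType} {m : nat} (a : 'rV[R]_m) (r : R) :
  compact [set y : 'rV[R]_m | `|y - a| <= r].
Proof.
apply: bounded_closed_compact.
  exists (`|a| + r); split; first exact: num_real.
  move=> s rs y /= yr; apply: le_trans (ltW rs); rewrite -[y](subrK a) addrC.
  by apply: le_trans (ler_normD _ _) _; rewrite lerD2l.
rewrite (_ : [set _ | _] = (fun y : 'rV[R]_m => `|y - a|) @^-1` [set x | x <= r])//.
apply: closed_comp => [y _|]; last exact: closed_le.
apply: (@continuous_comp _ _ _ (fun y : 'rV[R]_m => y - a) (fun y => `|y|)).
  by apply: (@continuousB _ _ _ id (cst a)); [exact: cvg_id|exact: cst_continuous].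
exact: norm_continuous.
Qed.

Lemma open_norm_ball {R : realType} {m : nat} (a : 'rV[R]_m) (r : R) :
  open [set y : 'rV[R]_m | `|y - a| < r].
Proof.
rewrite (_ : [set _ | _] = (fun y : 'rV[R]_m => `|y - a|) @^-1` [set x | x < r])//.
apply: open_comp => [y _|]; last exact: open_lt.
apply: (@continuous_comp _ _ _ (fun y : 'rV[R]_m => y - a) (fun y => `|y|)).
  by apply: (@continuousB _ _ _ id (cst a)); [exact: cvg_id|exact: cst_continuous].
exact: norm_continuous.
Qed.

Lemma smooth_onM {R : realType} {m : nat} (U : set 'rV[R]_m) f g : open U ->
  smooth_on U f -> smooth_on U g -> smooth_on U (f * g).
Proof. by move=> oU sf sg n; apply: class_CM. Qed.

Lemma smooth_on_sub {R : realType} {m : nat} (U V : set 'rV[R]_m) f : V `<=` U ->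
  smooth_on U f -> smooth_on V f.
Proof. by move=> VU sf n; exact: class_C_sub (sf n). Qed.

Section ManifoldFunctions.
Context {R : realType} {m : nat}.
Variable M : smooth_manifold R m.
Hypothesis hausdorffM : hausdorff_space M.
Implicit Types (c : chart R m M) (x z : M).

Lemma smooth_extend0 c g (K : set 'rV[R]_m) : atlas c -> K `<=` c @` chart_dom c ->
  compact K -> (forall y, ~ K y -> g y = 0) -> smooth_on (c @` chart_dom c) g ->
  extend0 c g \in @smooth_fun R m M.
Proof.
move=> ac Kc cK gK sg; apply/asboolP => d ad n.
apply: class_C_local => _ [x dx <-].
have [cx|ncx] := pselect (chart_dom c x).
  exists (d @` (chart_dom d `&` chart_dom c)); first by exists x.
  have oV : open (d @` (chart_dom d `&` chart_dom c)).
    by apply: chart_image_open; exact: chart_dom_open.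
  apply: (@eq_class_C _ _ _ _ (g \o (c \o chart_inv d))) => //.
    move=> y; rewrite inE => -[z [dz cz] <-] /=.
    by rewrite chart_mapK ?inE// extend0_in.
  apply: (@class_C_comp _ _ _ _ (c @` chart_dom c)) => //.
  - exact: chart_img_open.
  - by move=> _ [z [dz cz] <-] /=; rewrite chart_mapK ?inE//; exists z.
  - by move=> j; exact: atlas_compat.
have clK : closed (chart_inv c @` K) by apply: compact_closed => //; exact: chart_inv_compact.
exists (d @` (chart_dom d `&` ~` (chart_inv c @` K))).
  exists x => //; split=> // -[y /Kc [z cz <-]]; rewrite chart_mapK ?inE// => zx.
  by apply: ncx; rewrite -zx.
apply: (@eq_class_C _ _ _ _ (cst 0)).
- by apply: chart_image_open; exact: closed_openC.
- move=> y; rewrite inE => -[z [dz Kz] <-] /=.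
  by rewrite chart_mapK ?inE//; rewrite (extend0_out gK).
exact: class_C_cst.
Qed.

Lemma chart_ball (O : set M) x : open O -> O x ->
  exists c (r : R), [/\ atlas c, chart_dom c x, 0 < r &
    [set y | `|y - c x| <= 2 * r] `<=` c @` (chart_dom c `&` O)].
Proof.
move=> oO Ox; have [c ac cx] := atlas_cover x.
have : nbhs (c x) (c @` (chart_dom c `&` O)).
  by apply: open_nbhs_nbhs; split; [exact: chart_image_open|exists x].
move=> /nbhs_ballP[e /= e0 He]; exists c, (e / 4); split; rewrite ?divr_gt0//.
move=> y /= ye; apply: He; rewrite -ball_normE /= distrC; apply: le_lt_trans ye _.
by rewrite mulrCA gtr_pMr// ltr_pdivrMr// mul1r ltr_nat.
Qed.

(** The support condition is stated without closures: [rho] vanishes on an open [W] that covers the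
    manifold together with [O]. As [W] is open, the derivatives of [rho] vanish there too, and
    identities can be checked on [O] and on [W] separately. *)
Lemma exists_bump_manifold (O : set M) x : open O -> O x ->
  exists (rho : Cinf M) (V W : set M), [/\ open V /\ V x, open W,
    forall z, V z -> rho z = 1, forall z, W z -> rho z = 0 & forall z, O z \/ W z].
Proof.
move=> oO Ox; have [c [r [ac cx r0 Hr]]] := chart_ball oO Ox.
have [chi [schi chi1 chi0]] := exists_bump (c x) r0.
pose K := [set y | `|y - c x| <= 2 * r].
have Kc : K `<=` c @` chart_dom c by move=> y /Hr[z [cz _] <-]; exists z.
have cK : compact K by exact: closed_ball_compact.
have chiK y : ~ K y -> chi y = 0.
  by move=> /negP; rewrite -ltNge => /ltW; exact: chi0.
have srho : extend0 c chi \in @smooth_fun R m M.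
  apply: (smooth_extend0 ac Kc cK chiK); apply: (@smooth_on_sub _ _ setT) => //.
exists (MkCinf srho), (chart_dom c `&` c @^-1` [set y | `|y - c x| < r]), (~` (chart_inv c @` K)).
split=> /=.
- split; last by split => //=; rewrite subrr normr0.
  by apply: chart_preimage_open; exact: open_norm_ball.
- by apply: closed_openC; apply: compact_closed => //; exact: chart_inv_compact.
- by move=> z [cz /= /ltW zr]; rewrite extend0_in//; exact: chi1.
- by move=> z zK; exact: extend0_out zK.
- move=> z; have [|] := pselect ((chart_inv c @` K) z); last by right.
  by move=> [y /Hr [w [cw Ow] <-] <-]; left; rewrite chart_mapK ?inE.
Qed.

End ManifoldFunctions.

Section Frames.
Context {R : realType} {m : nat}.
Variable M : smooth_manifold R m.
Hypothesis hausdorffM : hausdorff_space M.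
Implicit Types (X : vfield M) (f g : Cinf M).

(** Functions and fields are global, since a [vfield M] acts on global functions only; they behave
    as coordinates and coordinate fields just over [U]. *)
Definition local_frame (U : set M) (x : 'I_m -> Cinf M) (d : 'I_m -> vfield M) :=
  (forall i j z, U z -> d i (x j) z = (i == j)%:R) /\
  (forall X f z, U z -> X f z = \sum_i X (x i) z * d i f z).

Lemma smooth_chart_inv (c : chart R m M) f : atlas c ->
  smooth_on (c @` chart_dom c) (f \o chart_inv c).
Proof. by move=> ac; have /asboolP/(_ c ac) := valP f. Qed.

Section ChartFields.
Variables (c : chart R m M) (chi : 'rV[R]_m -> R) (K : set 'rV[R]_m).
Hypotheses (ac : atlas c) (Kc : K `<=` c @` chart_dom c) (cK : compact K)
  (chiK : forall y, ~ K y -> chi y = 0) (schi : smooth_on setT chi).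

Lemma cutoff_smooth (u : 'rV[R]_m -> R) : smooth_on (c @` chart_dom c) u ->
  extend0 c (chi * u) \in @smooth_fun R m M.
Proof.
move=> sg; apply: (smooth_extend0 hausdorffM ac Kc cK).
  by move=> y /chiK Hy; rewrite fctE Hy mul0r.
apply: smooth_onM => //; first exact: chart_img_open.
by apply: (@smooth_on_sub _ _ setT).
Qed.

Definition cutoff (u : 'rV[R]_m -> R) (sg : smooth_on (c @` chart_dom c) u) : Cinf M :=
  MkCinf (cutoff_smooth sg).

Definition chart_partial i f : Cinf M :=
  cutoff (smooth_partial i (smooth_chart_inv f ac)).

Lemma chart_partial_in i f z : chart_dom c z ->
  chart_partial i f z = chi (c z) * partial i (f \o chart_inv c) (c z).
Proof. by move=> cz; rewrite /= extend0_in. Qed.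

Lemma chart_partial_out i f z : ~ chart_dom c z -> chart_partial i f z = 0.
Proof. by move=> cz; rewrite /= /extend0 memNset. Qed.

Lemma chart_derivable f z i : chart_dom c z ->
  derivable (f \o chart_inv c) (c z) (delta_mx 0 i : 'rV[R]_m).
Proof.
move=> cz; have [_ /(_ i)[+ _]] := smooth_chart_inv f ac 1%N.
by apply; rewrite inE; exists z.
Qed.

Lemma chart_partial_derivation i : chart_partial i \in @derivation R m M.
Proof.
apply/asboolP; split=> [a f g|f g]; apply: val_inj; apply/funext => z.
  have [cz|cz] := pselect (chart_dom c z); last first.
    rewrite [LHS](chart_partial_out i (a *: f + g) cz).
    by rewrite -[RHS]/(a * chart_partial i f z + chart_partial i g z) !chart_partial_out//
      mulr0 addr0.
  rewrite [LHS](chart_partial_in i (a *: f + g) cz).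
  rewrite -[RHS]/(a * chart_partial i f z + chart_partial i g z) !chart_partial_in//.
  rewrite (_ : (a *: f + g : Cinf M) \o chart_inv c = a *: (f \o chart_inv c) + (g \o
    chart_inv c))//.
  rewrite /partial deriveD; [|by apply: derivableZ; exact: chart_derivable|exact: chart_derivable].
  rewrite deriveZ; last exact: chart_derivable.
  by rewrite -[a *: _]/(a * _) mulrDr mulrCA.
have [cz|cz] := pselect (chart_dom c z); last first.
  rewrite [LHS](chart_partial_out i (f * g) cz).
  by rewrite -[RHS]/(chart_partial i f z * g z + f z * chart_partial i g z)
    !chart_partial_out// mulr0 mul0r addr0.
rewrite [LHS](chart_partial_in i (f * g) cz).
rewrite -[RHS]/(chart_partial i f z * g z + f z * chart_partial i g z) !chart_partial_in//.
rewrite (_ : (f * g : Cinf M) \o chart_inv c = (f \o chart_inv c) * (g \o chart_inv c))//.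
rewrite /partial deriveM; [|exact: chart_derivable|exact: chart_derivable].
rewrite /= chart_mapK ?inE// -![_ *: _]/(_ * _); ring.
Qed.

Definition chart_field i : vfield M := MkVfield (chart_partial_derivation i).

End ChartFields.

Lemma Cinf_eq f g : (forall z, f z = g z) -> f = g.
Proof. by move=> fg; apply: val_inj; apply/funext. Qed.

Lemma Cinf_sumE (I : Type) (r : seq I) (P : pred I) (F : I -> Cinf M) z :
  (\sum_(i <- r | P i) F i) z = \sum_(i <- r | P i) F i z.
Proof. by apply: (big_morph (fun f : Cinf M => f z)). Qed.

Lemma vfield_cst X (a : R) : X (a *: (1 : Cinf M)) = 0.
Proof.
rewrite linearZ /=; suff -> : X 1 = 0 by rewrite scaler0.
have := vfieldM X 1 1; rewrite !mulr1 mul1r => /eqP.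
by rewrite -subr_eq0 opprD addrA subrr sub0r oppr_eq0 => /eqP.
Qed.

Lemma exists_local_frame x0 : exists (U : set M) (x : 'I_m -> Cinf M) (d : 'I_m -> vfield M),
  [/\ open U, U x0, forall i, x i x0 = 0 & local_frame U x d].
Proof.
have [c [r [ac cx r0 Hr]]] := chart_ball (@openT M) (I : setT x0).
set a := c x0 in Hr; have [chi [schi chi1 chi0]] := exists_bump a r0.
pose K := [set y | `|y - a| <= 2 * r].
have Kc : K `<=` c @` chart_dom c by move=> y /Hr[z [cz _] <-]; exists z.
have cK : compact K by exact: closed_ball_compact.
have chiK y : ~ K y -> chi y = 0.
  by move=> /negP; rewrite -ltNge => /ltW; exact: chi0.
have sx i : smooth_on (c @` chart_dom c) (fun y => y 0 i - a 0 i).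
  move=> n; apply: (@class_CD _ _ _ _ (fun y : 'rV[R]_m => y 0 i) (cst (- a 0 i))).
  - exact: chart_img_open.
  - by apply: smooth_coord; exact: chart_img_open.
  - exact: class_C_cst.
pose x i := cutoff ac Kc cK chiK schi (sx i).
pose d i := chart_field ac Kc cK chiK schi i.
pose U := chart_dom c `&` c @^-1` [set y | `|y - a| < r].
have xE i z : U z -> x i z = c z 0 i - a 0 i.
  move=> [cz /= /ltW zr]; rewrite /= extend0_in// fctE chi1// mul1r.
  by [].
have oU : open U by apply: chart_preimage_open; exact: open_norm_ball.
have Ux0 : U x0 by split => //=; rewrite subrr normr0.
have dE i f z : U z -> d i f z = partial i (f \o chart_inv c) (c z).
  by move=> [cz /= /ltW zr]; rewrite [LHS](chart_partial_in ac Kc cK chiK schi)// chi1// mul1r.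
have dx i j z : U z -> d i (x j) z = (i == j)%:R.
  move=> Uz; rewrite dE// /partial.
  have /near_eq_derive -> : \forall y \near c z, (x j \o chart_inv c) y = y 0 j - a 0 j.
    have : nbhs (c z) (c @` (chart_dom c `&` U)).
      apply: open_nbhs_nbhs; split; first exact: chart_image_open.
      by exists z => //; case: Uz.
    by apply: filterS => _ [w [cw Uw] <-]; rewrite /= -/(x j) chart_mapK ?inE//; exact: xE.
  have H : is_derive (c z) (delta_mx 0 i : 'rV[R]_m) (fun y : 'rV[R]_m => y 0 j - a 0 j) (i
    == j)%:R.
    apply: (@is_derive_quadratic _ _ _ _ _ _ 0) => s.
    by rewrite !mxE eqxx /= eq_sym opprB addrA subrK addrK subrr normr0 mul0r.
  by have [_ ->] := H.
exists U, x, d; split => //.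
  by move=> i; rewrite xE// subrr.
split=> // X f z Uz; pose b := c z.
(* The factor [chi] yields a compactly supported smooth function on all of R^m, as Hadamard's lemma
   requires, and changes nothing over [U]. *)
pose H := chi * (f \o chart_inv c).
have sH : smooth_compact H.
  split.
    move=> n; apply: class_C_local => y _; have [yK|nyK] := pselect (K y).
      exists (c @` chart_dom c); first exact: (Kc _ yK).
      apply: smooth_onM; first exact: chart_img_open.
        exact: (@smooth_on_sub _ _ setT).
      exact: smooth_chart_inv.
    exists (~` K); first by [].
    have oK : open (~` K) by apply: closed_openC; apply: compact_closed => //;
      exact: norm_hausdorff.
    apply: (eq_class_C oK _ (class_C_cst n (~` K) 0)) => w; rewrite inE => wK.
    by rewrite /H !fctE chiK// mul0r.
  exists (`|a| + 2 * r) => y yr; rewrite /H fctE chiK ?mul0r// /K /= => yK.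
  move: yr; rewrite ltNge => /negP; apply; rewrite -[y](subrK a) addrC.
  by apply: le_trans (ler_normD _ _) _; rewrite lerD2l.
have HE w : U w -> H (c w) = f w.
  by move=> [cw /= /ltW wr]; rewrite /H fctE chi1// mul1r /= chart_mapK ?inE.
have sG i : smooth_on (c @` chart_dom c) (radial b 0 (partial i H)).
  by apply: (@smooth_on_sub _ _ setT) => //; apply: smooth_radial; exact: smooth_compact_partial.
pose G i := cutoff ac Kc cK chiK schi (sG i).
have fE w : U w -> f w - f z = \sum_i (x i w - x i z) * G i w.
  move=> Uw; rewrite -!HE// (Hadamard b (c w) sH); apply: eq_bigr => i _.
  rewrite !xE// opprB addrA subrK; congr (_ * _).
  by case: Uw => cw /= /ltW wr; rewrite extend0_in// fctE chi1// mul1r.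
have [rho [V [W [[_ Vz] _ rho1 rho0 UW]]]] := exists_bump_manifold hausdorffM oU Uz.
(* The Hadamard expansion holds over [U] only; multiplied by [rho] it becomes an identity of global
   functions, to which derivations can be applied. *)
have fG : rho * (f - f z *: (1 : Cinf M)) = \sum_i rho * ((x i - x i z *: (1 : Cinf M)) * G i).
  apply: Cinf_eq => w; rewrite Cinf_sumE.
  rewrite -[LHS]/(rho w * (f w - f z * 1)) mulr1.
  have [Uw|Ww] := UW w; last first.
    rewrite rho0// mul0r big1// => i _.
    by rewrite -[LHS]/(rho w * ((x i w - x i z * 1) * G i w)) rho0// mul0r.
  rewrite fE// mulr_sumr; apply: eq_bigr => i _.
  by rewrite -[RHS]/(rho w * ((x i w - x i z * 1) * G i w)) mulr1.
have key (Y : vfield M) : Y f z = \sum_i Y (x i) z * G i z.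
  have := congr1 (fun h => Cinf_val (Y h) z) fG.
  rewrite vfieldM linearB /= vfield_cst subr0 linear_sum /= Cinf_sumE.
  rewrite -[X in X = _ -> _]/(Y rho z * (f z - f z * 1) + rho z * Y f z).
  rewrite mulr1 subrr mulr0 add0r rho1// mul1r => ->.
  apply: eq_bigr => i _; rewrite vfieldM vfieldM linearB /= vfield_cst subr0.
  rewrite -[LHS]/(Y rho z * ((x i z - x i z * 1) * G i z) +
     rho z * (Y (x i) z * G i z + (x i z - x i z * 1) * Y (G i) z)).
  by rewrite mulr1 subrr !mul0r mulr0 add0r addr0 rho1// mul1r.
(* Applying [key] to [d i] itself identifies the coefficient [G i z] with [d i f z]. *)
rewrite key; apply: eq_bigr => i _; congr (_ * _).
rewrite key (bigD1 i)// dx// eqxx mul1r big1 => [|j /andP[_ ji]]; first by rewrite /= addr0.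
by rewrite dx// eq_sym (negbTE ji) mul0r.
Qed.

End Frames.

(** * Locality, forms and differential operators *)

Section Locality.
Context {R : realType} {m : nat}.
Variable M : smooth_manifold R m.
Hypothesis hausdorffM : hausdorff_space M.
Implicit Types (X Y : vfield M) (f g h : Cinf M) (O : set M).

(** A bump [rho] at [z] with support in [O] gives [rho * f = 0], and the Leibniz rule at [z]
    isolates [X f z]. Forms and differential operators are localized by the same device. *)
Lemma vfield_local O X f : open O -> (forall z, O z -> f z = 0) -> forall z, O z -> X f z = 0.
Proof.
move=> oO f0 z Oz.
have [rho [V [W [[_ Vz] _ rho1 rho0 OW]]]] := exists_bump_manifold hausdorffM oO Oz.
have rf : rho * f = 0.
  apply: Cinf_eq => w; rewrite -[LHS]/(rho w * f w).
  by have [/f0 ->|/rho0 ->] := OW w; rewrite ?mulr0 ?mul0r.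
have : X (rho * f) z = 0 by rewrite rf linear0.
rewrite vfieldM -[LHS]/(X rho z * f z + rho z * X f z).
by rewrite f0// mulr0 add0r rho1// mul1r.
Qed.

Lemma vfield_local_cst O X f (a : R) : open O -> (forall z, O z -> f z = a) ->
  forall z, O z -> X f z = 0.
Proof.
move=> oO fa z Oz.
have := vfield_local X oO (_ : forall z, O z -> (f - a *: (1 : Cinf M)) z = 0) Oz.
rewrite linearB /= vfield_cst subr0; apply=> w Ow.
by rewrite -[LHS]/(f w - a * 1) mulr1 fa// subrr.
Qed.

Section Forms.
Variable p : nat.
Implicit Types (v w : form M p) (Ys : 'I_p -> vfield M) (D : form M p -> Cinf M).

Fact fscale_linear f : linear (@fscale R m M p f).
Proof.
move=> a v w; apply: form_inj => Ys.
by rewrite form_lincombE !fscaleE form_lincombE mulrDr Cinf_scaleAr.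
Qed.

HB.instance Definition _ f :=
  GRing.isLinear.Build R (form M p) (form M p) _ (@fscale R m M p f) (fscale_linear f).

HB.instance Definition _ X :=
  GRing.isLinear.Build R (form M p) (form M p) _ (@lie_form R m M p X)
    (@lie_form_linear R m M p X).

Lemma form_scale w Ys i f X : w (upd Ys i (vscale f X)) = f * w (upd Ys i X).
Proof.
have w0 : w (upd Ys i 0) = 0.
  by have := form_add w Ys i 0 0; rewrite addr0 => /eqP;
    rewrite -subr_eq0 opprD addNKr oppr_eq0 => /eqP.
by have := form_lin w Ys i f X 0; rewrite !addr0 w0 addr0.
Qed.

Lemma form0E Ys : (0 : form M p) Ys = 0. Proof. by []. Qed.
Lemma formBE v w Ys : (v - w) Ys = v Ys - w Ys. Proof. by []. Qed.

Definition vanish_on O w := forall Ys z, O z -> w Ys z = 0.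

Lemma form_local w O Ys i X : open O -> (forall f z, O z -> X f z = 0) ->
  forall z, O z -> w (upd Ys i X) z = 0.
Proof.
move=> oO X0 z Oz.
have [rho [V [W [[_ Vz] _ rho1 rho0 OW]]]] := exists_bump_manifold hausdorffM oO Oz.
have rX : vscale rho X = vscale 0 X.
  apply: vfield_inj => f; apply: Cinf_eq => y; rewrite !vscaleE.
  rewrite -[LHS]/(rho y * X f y) -[RHS]/(0 * X f y) mul0r.
  by have [/X0 ->|/rho0 ->] := OW y; rewrite ?mulr0 ?mul0r.
have := congr1 (fun Z => w (upd Ys i Z) z) rX.
rewrite !form_scale mul0r -[LHS]/(rho z * w (upd Ys i X) z) rho1// mul1r.
by [].
Qed.

Lemma form_local_eq w O Ys i X Y : open O -> (forall f z, O z -> X f z = Y f z) ->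
  forall z, O z -> w (upd Ys i X) z = w (upd Ys i Y) z.
Proof.
move=> oO XY z Oz; have := form_local w Ys i oO (_ : forall f z, O z -> (X - Y) f z = 0) Oz.
have E : w (upd Ys i X) = w (upd Ys i (X - Y)) + w (upd Ys i Y).
  by rewrite -form_add subrK.
rewrite E -[(_ + w (upd Ys i Y)) z]/(w (upd Ys i (X - Y)) z + w (upd Ys i Y) z) => ->.
  by rewrite add0r.
by move=> f y Oy; rewrite -[LHS]/(X f y - Y f y) XY// subrr.
Qed.

Lemma vanish_on_lie O X w : open O -> vanish_on O w -> vanish_on O (lie_form X w).
Proof.
move=> oO w0 Ys z Oz; rewrite lie_formE.
rewrite -[LHS]/(X (w Ys) z - (\sum_i w (upd Ys i (vbracket X (Ys i)))) z).
rewrite Cinf_sumE big1 ?subr0 => [|i _]; last exact: w0.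
by apply: (vfield_local X oO _ Oz) => y; exact: w0.
Qed.

Lemma linear_at0 D : linear D -> D 0 = 0.
Proof. by move=> /(_ (-1) 0 0); rewrite scaler0 addr0 scaleN1r addNr. Qed.

(** Induction on the order: since [rho w = 0], the commutator of [D] with [rho] sends [w] to
    [- rho * D w], and it has smaller order. *)
Lemma order_le_local k D O w : open O -> linear D -> order_le k D -> vanish_on O w ->
  forall z, O z -> D w z = 0.
Proof.
move=> oO; elim: k D => [|k IHk] D lD oD w0 z Oz;
  have [rho [V [W [[_ Vz] _ rho1 rho0 OW]]]] := exists_bump_manifold hausdorffM oO Oz;
  have rw0 : fscale rho w = 0.
- apply: form_inj => Ys; apply: Cinf_eq => y; rewrite fscaleE form0E.
  rewrite -[LHS]/(rho y * w Ys y) -[RHS]/(0 : R).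
  by have [/w0 ->|/rho0 ->] := OW y; rewrite ?mulr0 ?mul0r.
- have D0 := linear_at0 lD.
  have := congr1 (fun h => Cinf_val h z) (oD rho w); rewrite rw0 D0.
  by rewrite -[RHS]/(rho z * D w z) rho1// mul1r.
- apply: form_inj => Ys; apply: Cinf_eq => y; rewrite fscaleE form0E.
  rewrite -[LHS]/(rho y * w Ys y) -[RHS]/(0 : R).
  by have [/w0 ->|/rho0 ->] := OW y; rewrite ?mulr0 ?mul0r.
have lC : linear (commutator D rho).
  move=> a v u; rewrite /commutator fscale_linear !lD mulrDr -Cinf_scaleAr.
  by rewrite opprD addrACA scalerBr.
have := IHk _ lC (oD rho) w0 z Oz.
have D0 := linear_at0 lD.
rewrite /commutator rw0 D0 sub0r -[LHS]/(- (rho z * D w z)) rho1// mul1r => /eqP.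
by rewrite oppr_eq0 => /eqP.
Qed.

End Forms.
End Locality.

(** * The algebra of the operators [dx /\ i_X] on forms *)

Section FormAlgebra.
Context {R : realType} {m : nat}.
Variable M : smooth_manifold R m.
Hypothesis hausdorffM : hausdorff_space M.
Variable p : nat.
Implicit Types (X Y : vfield M) (f g h x y : Cinf M) (O : set M).
Implicit Types (v w : form M p) (Ys : 'I_p -> vfield M) (phi psi : vfield M -> vfield M).

(** The off-diagonal part of a composition of two operators that act slot by slot. It is symmetric
    in [phi] and [psi], so it cancels in commutators and only one-slot terms survive. *)
Definition slot_sum2 phi psi w Ys :=
  \sum_i \sum_(j | j != i) w (upd (upd Ys i (phi (Ys i))) j (psi (Ys j))).

Lemma slot_sum2C phi psi w Ys : slot_sum2 phi psi w Ys = slot_sum2 psi phi w Ys.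
Proof.
rewrite /slot_sum2 (exchange_big_dep xpredT)//=; apply: eq_bigr => j _.
rewrite (eq_bigl (fun i => i != j)); last by move=> i; rewrite eq_sym.
by apply: eq_bigr => i ij; rewrite updC.
Qed.

Lemma slot_sum_comp phi psi w Ys :
  \sum_i \sum_j w (upd (upd Ys i (phi (Ys i))) j (psi (upd Ys i (phi (Ys i)) j))) =
  \sum_i w (upd Ys i (psi (phi (Ys i)))) + slot_sum2 phi psi w Ys.
Proof.
rewrite -big_split; apply: eq_bigr => i _ /=.
rewrite (bigD1 i)//= upd_same {2}/upd eqxx; congr (_ + _).
by apply: eq_bigr => j ji; congr (w (upd _ _ (psi _))); rewrite /upd (negbTE ji).
Qed.

Lemma vbracket_vscale f X Y g :
  vbracket (vscale f X) Y g = (f * vbracket X Y g - Y f * X g).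
Proof. by rewrite !vbracketE !vscaleE vfieldM; ring. Qed.

Lemma vfield_sum X (I : Type) (r : seq I) (F : I -> Cinf M) :
  X (\sum_(i <- r) F i) = \sum_(i <- r) X (F i).
Proof. exact: raddf_sum. Qed.

(** This is [w |-> dx /\ i_X w]. As a difference of Lie derivatives it needs no exterior product,
    and it is exactly the term by which [L_{xX}] differs from [x L_X]. *)
Definition dform x X : form M p -> form M p :=
  fun w => lie_form (vscale x X) w - fscale x (lie_form X w).

Arguments dform : simpl never.

Lemma dformE x X w Ys : dform x X w Ys = \sum_i w (upd Ys i (vscale (Ys i x) X)).
Proof.
rewrite /dform formBE fscaleE !lie_formE vscaleE mulrBr.
have -> : \sum_i w (upd Ys i (vbracket (vscale x X) (Ys i))) =
    x * (\sum_i w (upd Ys i (vbracket X (Ys i)))) - \sum_i w (upd Ys i (vscale (Ys i x) X)).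
  rewrite mulr_sumr -sumrB; apply: eq_bigr => i _.
  have -> : vbracket (vscale x X) (Ys i) = vscale x (vbracket X (Ys i)) + vscale (- Ys i x) X.
    apply: vfield_inj => g; rewrite vbracket_vscale vfieldD !vscaleE; ring.
  by rewrite form_add !form_scale mulNr.
ring.
Qed.

Fact dform_linear x X : linear (dform x X).
Proof. by move=> a v w; rewrite /dform !lie_form_linear fscale_linear scalerBr opprD addrACA. Qed.

HB.instance Definition _ x X :=
  GRing.isLinear.Build R (form M p) (form M p) _ (dform x X) (dform_linear x X).

Lemma dform_fscale x X f w : dform x X (fscale f w) = fscale f (dform x X w).
Proof.
apply: form_inj => Ys; rewrite fscaleE !dformE mulr_sumr; apply: eq_bigr => i _.
by rewrite fscaleE.
Qed.

Lemma dform_sqr x X w : dform (x * x) X w = fscale x (dform x X w) *+ 2.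
Proof.
apply: form_inj => Ys.
rewrite mulr2n dformE formD fscaleE dformE mulr_sumr -big_split; apply: eq_bigr => i _ /=.
by rewrite !form_scale vfieldM; ring.
Qed.

Lemma vanish_on_dform O x X w : open O -> vanish_on O w -> vanish_on O (dform x X w).
Proof.
by move=> oO w0 Ys z Oz; rewrite dformE Cinf_sumE big1// => i _; exact: w0.
Qed.

(** [L_X] annihilates [dx] because [X x] is constant on [O], and it commutes with [i_X] because
    [[X, X] = 0]. *)
Lemma lie_dform O x X w : open O -> (forall z, O z -> X x z = 1) ->
  vanish_on O (lie_form X (dform x X w) - dform x X (lie_form X w)).
Proof.
move=> oO x1 Ys z Oz; pose phi Y := vscale (Y x) X.
have E : (lie_form X (dform x X w) - dform x X (lie_form X w)) Ys =
    \sum_i Ys i (X x) * w (upd Ys i X).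
  rewrite formBE lie_formE (dformE _ _ (lie_form X w)) dformE vfield_sum.
  under [X in _ - X = _]eq_bigr do rewrite lie_formE.
  under [X in _ - X - _ = _]eq_bigr do rewrite dformE.
  rewrite sumrB (slot_sum_comp (vbracket X) phi) (slot_sum_comp phi (vbracket X)).
  rewrite (slot_sum2C (vbracket X)).
  set S := slot_sum2 _ _ _ _; set A := \sum_i X _; set B := \sum_i _; set C := \sum_i _.
  rewrite (_ : A - (B + S) - (A - (C + S)) = C - B); last by ring.
  rewrite /C /B -sumrB; apply: eq_bigr => i _; rewrite /phi.
  have -> : vbracket X (vscale (Ys i x) X) = vscale (X (Ys i x)) X.
    by apply: vfield_inj => g; rewrite vbracketE !vscaleE vfieldM; ring.
  by rewrite !form_scale vbracketE; ring.
rewrite E Cinf_sumE big1// => i _.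
rewrite -[LHS]/(Ys i (X x) z * w (upd Ys i X) z).
by rewrite (vfield_local_cst hausdorffM _ oO x1)// mul0r.
Qed.

(** The off-diagonal terms put [X] into two slots and vanish by alternation; the diagonal ones
    acquire a factor [X x], which is 1. *)
Lemma dform_idem O x X w : open O -> (forall z, O z -> X x z = 1) ->
  vanish_on O (dform x X (dform x X w) - dform x X w).
Proof.
move=> oO x1 Ys z Oz; pose phi Y := vscale (Y x) X.
have E : (dform x X (dform x X w) - dform x X w) Ys =
    \sum_i Ys i x * (X x - 1) * w (upd Ys i X).
  rewrite formBE dformE (dformE x X w).
  under [X in X - _ = _]eq_bigr do rewrite dformE.
  rewrite (slot_sum_comp phi phi).
  have -> : slot_sum2 phi phi w Ys = 0.
    apply: big1 => i _; apply: big1 => j ji; rewrite form_scale updC 1?eq_sym// form_scale.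
    rewrite (@form_alt _ _ _ _ w _ i j) ?mulr0 1?eq_sym//.
    by rewrite /upd !eqxx (negbTE ji).
  rewrite addr0 -sumrB; apply: eq_bigr => i _.
  by rewrite /phi !form_scale vscaleE; ring.
rewrite E Cinf_sumE big1// => i _.
rewrite -[LHS]/(Ys i x z * (X x z - 1) * w (upd Ys i X) z).
by rewrite x1// subrr mulr0 mul0r.
Qed.

Lemma dformC O x X y Y w : open O -> (forall z, O z -> X y z = 0) ->
  (forall z, O z -> Y x z = 0) ->
  vanish_on O (dform x X (dform y Y w) - dform y Y (dform x X w)).
Proof.
move=> oO Xy Yx Ys z Oz; pose phi Z := vscale (Z x) X; pose psi Z := vscale (Z y) Y.
have E : (dform x X (dform y Y w) - dform y Y (dform x X w)) Ys =
    \sum_i (Ys i x * X y * w (upd Ys i Y) - Ys i y * Y x * w (upd Ys i X)).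
  rewrite formBE (dformE x X (dform y Y w)) (dformE y Y (dform x X w)).
  under [X in X - _ = _]eq_bigr do rewrite dformE.
  under [X in _ - X = _]eq_bigr do rewrite dformE.
  rewrite (slot_sum_comp phi psi) (slot_sum_comp psi phi) (slot_sum2C psi).
  rewrite opprD addrACA subrr addr0 -sumrB; apply: eq_bigr => i _.
  by rewrite /phi /psi !form_scale !vscaleE; ring.
rewrite E Cinf_sumE big1// => i _.
rewrite -[LHS]/(Ys i x z * X y z * w (upd Ys i Y) z - Ys i y z * Y x z * w (upd Ys i X) z).
by rewrite Xy// Yx// !mulr0 !mul0r subrr.
Qed.

End FormAlgebra.

(** * Operators supported in an open set *)

Section Supported.
Context {R : realType} {m : nat}.
Variable M : smooth_manifold R m.
Hypothesis hausdorffM : hausdorff_space M.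
Variables (p : nat) (O : set M).
Implicit Types (X Y : vfield M) (f g h x y : Cinf M) (v w : form M p).

(* The last condition says that [D w] is supported in the closure of [O]. *)
Definition supported : {pred (form M p -> Cinf M)} := fun D =>
  `[< [/\ linear D, forall v, vanish_on O v -> D v = 0 &
      forall h w, (forall z, O z -> h z = 0) -> h * D w = 0] >].

Fact supported_submod : submod_closed supported.
Proof.
split=> [|a D E /asboolP[lD rD hD] /asboolP[lE rE hE]]; apply/asboolP; split.
- by move=> a f g; rewrite !fct0E scaler0 addr0.
- by [].
- by move=> f w _; rewrite fct0E mulr0.
- move=> b v w; rewrite !fct_lincombE lD lE !scalerDr !scalerA mulrC.
  by rewrite addrACA.
- by move=> v v0; rewrite fct_lincombE rD// rE// scaler0 addr0.
- by move=> f w f0; rewrite fct_lincombE mulrDr -Cinf_scaleAr hD// hE// scaler0 addr0.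
Qed.

HB.instance Definition _ :=
  GRing.isSubmodClosed.Build R (form M p -> Cinf M) supported supported_submod.

(** No order bound is built in, because [neg_pre] raises the order; one type must be stable under
    all the operators below, and the order is tracked by [sop_order]. *)
Record sop := MkSop { sop_val :> form M p -> Cinf M; _ : sop_val \in supported }.

HB.instance Definition _ := [isSub for sop_val].
HB.instance Definition _ := [Choice of sop by <:].
HB.instance Definition _ := [SubChoice_isSubLmodule of sop by <:].
Implicit Types D E : sop.

Lemma sop_linear D : linear D. Proof. by have /asboolP[] := valP D. Qed.

HB.instance Definition _ D := GRing.isLinear.Build R (form M p) (Cinf M) _ D (sop_linear D).

Lemma sop_vanish D v : vanish_on O v -> D v = 0.
Proof. by have /asboolP[_ + _] := valP D; apply. Qed.

Lemma sop_mul0 D f w : (forall z, O z -> f z = 0) -> f * D w = 0.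
Proof. by have /asboolP[_ _] := valP D; apply. Qed.

Lemma sop_eq D E : (forall w, D w = E w) -> D = E.
Proof. by move=> DE; apply: val_inj; apply/funext. Qed.

Lemma sop_eqz D E : (forall w z, D w z = E w z) -> D = E.
Proof. by move=> DE; apply: sop_eq => w; apply: Cinf_eq. Qed.

Lemma sopD D E w z : (D + E) w z = D w z + E w z. Proof. by []. Qed.
Lemma sopN D w z : (- D) w z = - D w z. Proof. by []. Qed.
Lemma sopZ a D w z : (a *: D) w z = a * D w z. Proof. by []. Qed.
Lemma sop0 w z : (0 : sop) w z = 0. Proof. by []. Qed.

Lemma sop_argD D v w : D (v + w) = D v + D w. Proof. exact: raddfD. Qed.

Lemma sop_vanish_eq D v w : vanish_on O (v - w) -> D v = D w.
Proof.
by move=> /(sop_vanish D) /eqP; rewrite raddfB /= subr_eq0 => /eqP.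
Qed.

Lemma sop_lmul1 D f w : (forall z, O z -> f z = 1) -> f * D w = D w.
Proof.
move=> f1; apply/eqP; rewrite -subr_eq0 -[X in _ - X]mul1r -mulrBl; apply/eqP.
by apply: sop_mul0 => z Oz; rewrite -[LHS]/(f z - 1) f1// subrr.
Qed.

Lemma sop_rmul1 D f w : (forall z, O z -> f z = 1) -> D (fscale f w) = D w.
Proof.
move=> f1; apply: sop_vanish_eq => Ys z Oz.
by rewrite formBE fscaleE -[LHS]/(f z * w Ys z - w Ys z) f1// mul1r subrr.
Qed.

Hypothesis oO : open O.

Fact lmul_subproof x D : (fun w => x * D w) \in supported.
Proof.
apply/asboolP; split=> [a v w|v v0|f w f0].
- by rewrite sop_linear mulrDr -Cinf_scaleAr.
- by rewrite sop_vanish// mulr0.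
- by rewrite mulrCA sop_mul0// mulr0.
Qed.
Definition lmul x D := MkSop (lmul_subproof x D).

Fact ad_subproof x D : (fun w => D (fscale x w) - x * D w) \in supported.
Proof.
apply/asboolP; split=> [a v w|v v0|f w f0].
- by rewrite fscale_linear !sop_linear mulrDr -Cinf_scaleAr scalerBr opprD addrACA.
- rewrite !sop_vanish// ?mulr0 ?subrr// => Ys z Oz.
  by rewrite fscaleE -[LHS]/(x z * v Ys z) v0// mulr0.
- by rewrite mulrBr mulrCA !sop_mul0// mulr0 subrr.
Qed.
Definition ad x D := MkSop (ad_subproof x D).

Fact neg_pre_subproof X D : (fun w => - D (lie_form X w)) \in supported.
Proof.
apply/asboolP; split=> [a v w|v v0|f w f0].
- by rewrite lie_form_linear sop_linear scalerN opprD.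
- by rewrite sop_vanish ?oppr0//; exact: vanish_on_lie.
- by rewrite mulrN sop_mul0// oppr0.
Qed.
Definition neg_pre X D := MkSop (neg_pre_subproof X D).

Fact lie_subproof X D : (fun w => X (D w) - D (lie_form X w)) \in supported.
Proof.
apply/asboolP; split=> [a v w|v v0|f w f0].
- by rewrite lie_form_linear !sop_linear vfieldP scalerBr opprD addrACA.
- by rewrite sop_vanish// linear0 sop_vanish ?subrr//; exact: vanish_on_lie.
- rewrite mulrBr (sop_mul0 _ _ f0) subr0.
  have : X (f * D w) = 0 by rewrite sop_mul0// linear0.
  rewrite vfieldM sop_mul0 ?add0r//.
  by apply: (vfield_local hausdorffM).
Qed.
Definition slie X D := MkSop (lie_subproof X D).

Fact dform_subproof x X D : (fun w => D (dform x X w)) \in supported.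
Proof.
apply/asboolP; split=> [a v w|v v0|f w f0].
- by rewrite dform_linear sop_linear.
- by rewrite sop_vanish//; exact: vanish_on_dform.
- by rewrite sop_mul0.
Qed.
Definition pre_dform x X D := MkSop (dform_subproof x X D).
Lemma adE x D w : ad x D w = D (fscale x w) - x * D w. Proof. by []. Qed.
Lemma neg_preE X D w : neg_pre X D w = - D (lie_form X w). Proof. by []. Qed.
Lemma slieE X D w : slie X D w = X (D w) - D (lie_form X w). Proof. by []. Qed.
Lemma pre_dformE x X D w : pre_dform x X D w = D (dform x X w). Proof. by []. Qed.

Fact lmul_linear x : linear (lmul x).
Proof.
move=> a D E; apply: sop_eq => w; rewrite -[RHS]/(a *: (x * D w) + x * E w).
by rewrite -[LHS]/(x * (a *: D w + E w)) mulrDr -Cinf_scaleAr.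
Qed.
HB.instance Definition _ x := GRing.isLinear.Build R sop sop _ (lmul x) (lmul_linear x).

Fact ad_linear x : linear (ad x).
Proof.
move=> a D E; apply: sop_eqz => w z; rewrite sopD sopZ !adE.
rewrite -[LHS]/(a * D (fscale x w) z + E (fscale x w) z - x z * (a * D w z + E w z)).
rewrite -[RHS]/(a * (D (fscale x w) z - x z * D w z) + (E (fscale x w) z - x z * E w z)).
ring.
Qed.
HB.instance Definition _ x := GRing.isLinear.Build R sop sop _ (ad x) (ad_linear x).

Fact neg_pre_linear X : linear (neg_pre X).
Proof.
move=> a D E; apply: sop_eqz => w z; rewrite sopD sopZ !neg_preE.
rewrite -[LHS]/(- (a * D (lie_form X w) z + E (lie_form X w) z)).
by rewrite -[RHS]/(a * - D (lie_form X w) z - E (lie_form X w) z) opprD mulrN.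
Qed.
HB.instance Definition _ X := GRing.isLinear.Build R sop sop _ (neg_pre X) (neg_pre_linear X).

Fact slie_linear X : linear (slie X).
Proof.
move=> a D E; apply: sop_eq => w.
rewrite -[RHS]/(a *: (X (D w) - D (lie_form X w)) + (X (E w) - E (lie_form X w))).
rewrite -[LHS]/(X (a *: D w + E w) - (a *: D (lie_form X w) + E (lie_form X w))).
by rewrite vfieldP scalerBr opprD addrACA.
Qed.
HB.instance Definition _ X := GRing.isLinear.Build R sop sop _ (slie X) (slie_linear X).

Fact pre_dform_linear x X : linear (pre_dform x X).
Proof. by move=> a D E; apply: sop_eq => w. Qed.
HB.instance Definition _ x X :=
  GRing.isLinear.Build R sop sop _ (pre_dform x X) (pre_dform_linear x X).

(** * Commutation relations of the operators [l], [e], [b], [L] and [P] *)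

Section Conjugate.
Variables (x : Cinf M) (X : vfield M).
Hypothesis x1 : forall z, O z -> X x z = 1.

Local Notation l := (lmul x).
Local Notation e := (ad x).
Local Notation b := (neg_pre X).
Local Notation L := (slie X).
Local Notation P := (pre_dform x X).

Lemma slie_lmul D : L (l D) = l (L D) + D.
Proof.
apply: sop_eq => w; rewrite -[RHS]/(x * (X (D w) - D (lie_form X w)) + D w).
rewrite -[LHS]/(X (x * D w) - x * D (lie_form X w)) vfieldM (sop_lmul1 _ _ x1); ring.
Qed.

Lemma slie_ad D : L (e D) = e (L D).
Proof.
apply: sop_eq => w.
rewrite -[LHS]/(X (D (fscale x w) - x * D w) -
  (D (fscale x (lie_form X w)) - x * D (lie_form X w))).
rewrite -[RHS]/(X (D (fscale x w)) - D (lie_form X (fscale x w)) -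
  x * (X (D w) - D (lie_form X w))).
rewrite (raddfB X) /= vfieldM lie_form_scale sop_argD (sop_rmul1 _ _ x1) (sop_lmul1 _ _ x1).
ring.
Qed.

Lemma slie_neg_pre D : L (b D) = b (L D).
Proof.
apply: sop_eq => w.
rewrite -[LHS]/(X (- D (lie_form X w)) - - D (lie_form X (lie_form X w))).
rewrite -[RHS]/(- (X (D (lie_form X w)) - D (lie_form X (lie_form X w)))).
by rewrite raddfN /= opprD.
Qed.

Lemma slie_pre_dform D : L (P D) = P (L D).
Proof.
apply: sop_eq => w.
rewrite -[LHS]/(X (D (dform x X w)) - D (dform x X (lie_form X w))).
rewrite -[RHS]/(X (D (dform x X w)) - D (lie_form X (dform x X w))).
congr (_ - _); apply/esym; apply: sop_vanish_eq; exact: lie_dform.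
Qed.

(** The Weyl relation: on symbols, with [xi] the variable dual to [x], [e] is the derivative in [xi]
    and [b] is multiplication by [- xi]. So [- b e] counts the degree in [xi]. *)
Lemma neg_pre_ad D : b (e D) = e (b D) + D.
Proof.
apply: sop_eq => w.
rewrite -[LHS]/(- (D (fscale x (lie_form X w)) - x * D (lie_form X w))).
rewrite -[RHS]/(- D (lie_form X (fscale x w)) - x * - D (lie_form X w) + D w).
rewrite lie_form_scale sop_argD (sop_rmul1 _ _ x1); ring.
Qed.

Lemma lmul_ad D : l (e D) = e (l D).
Proof.
apply: sop_eq => w.
rewrite -[LHS]/(x * (D (fscale x w) - x * D w)).
rewrite -[RHS]/(x * D (fscale x w) - x * (x * D w)); ring.
Qed.

Lemma lmul_neg_pre y Y D : lmul y (neg_pre Y D) = neg_pre Y (lmul y D).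
Proof.
apply: sop_eq => w; rewrite -[LHS]/(y * - D (lie_form Y w)).
by rewrite -[RHS]/(- (y * D (lie_form Y w))) mulrN.
Qed.

Lemma lmul_pre_dform D : l (P D) = P (l D).
Proof. exact: sop_eq. Qed.

Lemma pre_dform_ad y Y f D : pre_dform y Y (ad f D) = ad f (pre_dform y Y D).
Proof.
apply: sop_eq => w; rewrite -[LHS]/(D (fscale f (dform y Y w)) - f * D (dform y Y w)).
by rewrite -[RHS]/(D (dform y Y (fscale f w)) - f * D (dform y Y w)) dform_fscale.
Qed.

Lemma pre_dform_neg_pre D : P (b D) = b (P D).
Proof.
apply: sop_eq => w; rewrite -[LHS]/(- D (lie_form X (dform x X w))).
rewrite -[RHS]/(- D (dform x X (lie_form X w))); congr (- _).
apply: sop_vanish_eq; exact: lie_dform.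
Qed.

Lemma pre_dform_idem D : P (P D) = P D.
Proof.
apply: sop_eq => w; rewrite -[LHS]/(D (dform x X (dform x X w))) -[RHS]/(D (dform x X w)).
by apply: sop_vanish_eq; exact: dform_idem.
Qed.

End Conjugate.
End Supported.

(** * The order filtration and the Casimir operators *)

Lemma sl2_comb_linear (R : realType) (V : lmodType R) (f1 f2 f3 : {linear V -> V}) :
  linear (fun v => f1 (f2 v) - 2 *: f3 (f3 v) + f2 (f1 v)).
Proof.
move=> a u v.
have E (f : {linear V -> V}) c w w' : f (c *: w + w') = c *: f w + f w' by exact: linearP.
have H (x1 x2 y1 y2 z1 z2 : V) : x1 + x2 + (y1 + y2) + (z1 + z2) = x1 + y1 + z1 + (x2 + y2 + z2).
  by rewrite [x1 + x2 + _]addrACA [LHS]addrACA.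
by rewrite !E /= H -!scalerDr.
Qed.

Section Order.
Context {R : realType} {m : nat}.
Variable M : smooth_manifold R m.
Hypothesis hausdorffM : hausdorff_space M.
Variable p : nat.
Implicit Types (X Y : vfield M) (f g h x y : Cinf M) (v w : form M p).

Section RawOrder.
Implicit Types D : form M p -> Cinf M.

Lemma order_le_mono k D : order_le k D -> order_le k.+1 D.
Proof.
elim: k D => [|k IHk] D oD f; last exact/IHk/oD.
by move=> g w; rewrite /commutator !oD; ring.
Qed.

Lemma order_le_leq j k D : (j <= k)%N -> order_le j D -> order_le k D.
Proof.
move=> /subnK <-; elim: (k - j)%N => [|n IHn] // oD.
by rewrite addSn; apply: order_le_mono; exact: IHn.
Qed.

Lemma order_le_rmul k D h : order_le k D -> order_le k (fun w => D (fscale h w)).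
Proof.
have sC f w : fscale h (fscale f w) = fscale f (fscale h w).
  by apply: form_inj => Ys; rewrite !fscaleE mulrCA.
elim: k D => [|k IHk] D oD f /=; first by move=> w; rewrite sC oD.
rewrite (_ : commutator _ f = (fun w => commutator D f (fscale h w))).
  exact/IHk/oD.
by apply/funext => w; rewrite /commutator sC.
Qed.

Lemma order_le_dform k D x X : order_le k D -> order_le k (fun w => D (dform x X w)).
Proof.
elim: k D => [|k IHk] D oD f /=; first by move=> w; rewrite dform_fscale oD.
rewrite (_ : commutator _ f = (fun w => commutator D f (dform x X w))).
  exact/IHk/oD.
by apply/funext => w; rewrite /commutator dform_fscale.
Qed.

Lemma order_le_pre_lie k D X : linear D -> order_le k D ->
  order_le k.+1 (fun w => D (lie_form X w)).
Proof.
elim: k D => [|k IHk] D lD oD f.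
  have DD u v : D (u + v) = D u + D v by have := lD 1 u v; rewrite !scale1r.
  by move=> g w; rewrite /commutator !lie_form_scale !DD !oD !DD !oD; ring.
have DD u v : D (u + v) = D u + D v by have := lD 1 u v; rewrite !scale1r.
rewrite (_ : commutator _ f = 1 *: (fun w => D (fscale (X f) w)) +
    (fun w => commutator D f (lie_form X w))); last first.
  by apply/funext => w; rewrite fct_lincombE scale1r /commutator lie_form_scale DD addrA.
apply: (@order_le_lincomb _ _ _ _ k.+1); first exact: (@order_le_rmul k.+1).
apply: IHk; last exact: oD.
move=> a v w; rewrite /commutator fscale_linear !lD mulrDr -Cinf_scaleAr.
by rewrite opprD addrACA scalerBr.
Qed.

End RawOrder.

Variable O : set M.
Hypothesis oO : open O.
Implicit Types D E : sop p O.

(** The index is shifted by one, order strictly below [j], so that a descending induction on the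
    order ends with [D = 0]. *)
Definition sop_order j D := if j is j'.+1 then order_le j' D else D = 0.

Lemma sop_order_lincomb j a D E : sop_order j D -> sop_order j E ->
  sop_order j (a *: D + E).
Proof.
case: j => [|j] /=; first by move=> -> ->; rewrite scaler0 addr0.
exact: order_le_lincomb.
Qed.

Lemma sop_order0 j : sop_order j 0.
Proof. by case: j => [|j] //=; exact: order_le0. Qed.

Lemma sop_orderZ j a D : sop_order j D -> sop_order j (a *: D).
Proof. by move=> oD; rewrite -[_ *: _]addr0; exact: sop_order_lincomb (sop_order0 j). Qed.

Lemma sop_orderD j D E : sop_order j D -> sop_order j E -> sop_order j (D + E).
Proof. by move=> oD oE; rewrite -[D]scale1r; exact: sop_order_lincomb. Qed.

Lemma sop_orderN j D : sop_order j D -> sop_order j (- D).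
Proof. by rewrite -scaleN1r; exact: sop_orderZ. Qed.

Lemma sop_orderB j D E : sop_order j D -> sop_order j E -> sop_order j (D - E).
Proof. by move=> oD /sop_orderN; exact: sop_orderD. Qed.

Lemma sop_order_sum j (I : Type) (r : seq I) (F : I -> sop p O) :
  (forall i, sop_order j (F i)) -> sop_order j (\sum_(i <- r) F i).
Proof.
by move=> oF; elim/big_ind: _ => //; [exact: sop_order0|move=> ? ?; exact: sop_orderD].
Qed.

Lemma sop_orderZK j a D : a != 0 -> sop_order j (a *: D) -> sop_order j D.
Proof. by move=> a0 /(sop_orderZ a^-1); rewrite scalerA mulVf// scale1r. Qed.

Lemma sop_order_ad j f D : sop_order j.+1 D -> sop_order j (ad f D).
Proof.
case: j => [oD|j oD]; last exact: oD.
by apply: sop_eq => w; rewrite adE oD subrr.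
Qed.

Lemma sop_order_neg_pre j X D : sop_order j D -> sop_order j.+1 (neg_pre hausdorffM oO X D).
Proof.
case: j => [->|j oD]; first by rewrite linear0; exact: sop_order0.
rewrite -[sop_order _ _]/(order_le j.+1 (fun w => - D (lie_form X w))).
rewrite (_ : (fun w => - _) = -1 *: (fun w => D (lie_form X w)) + 0).
  apply: (@order_le_lincomb _ _ _ _ j.+1); last exact: order_le0.
  by apply: order_le_pre_lie => //; exact: sop_linear.
by apply/funext => w; rewrite fct_lincombE scaleN1r addr0.
Qed.

Lemma sop_order_pre_dform j x X D : sop_order j D -> sop_order j (pre_dform oO x X D).
Proof. by case: j => [->|j oD]; [rewrite linear0|exact: order_le_dform]. Qed.

Lemma sop_order_slie j X D : sop_order j D -> sop_order j (slie hausdorffM oO X D).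
Proof.
by case: j => [->|j oD]; [rewrite linear0|apply: lie_order_le => //; exact: sop_linear].
Qed.

Section Casimir.
Variables (x : Cinf M) (X : vfield M).
Hypothesis x1 : forall z, O z -> X x z = 1.

Local Notation l := (lmul x).
Local Notation e := (ad x).
Local Notation b := (neg_pre hausdorffM oO X).
Local Notation L := (slie hausdorffM oO X).
Local Notation P := (pre_dform oO x X).

Let Ll D : L (l D) = l (L D) + D. Proof. exact: slie_lmul. Qed.
Let Le D : L (e D) = e (L D). Proof. exact: slie_ad. Qed.
Let Lb D : L (b D) = b (L D). Proof. exact: slie_neg_pre. Qed.
Let LP D : L (P D) = P (L D). Proof. exact: slie_pre_dform. Qed.
Let be D : b (e D) = e (b D) + D. Proof. exact: neg_pre_ad. Qed.
Let Pe D : P (e D) = e (P D). Proof. exact: pre_dform_ad. Qed.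
Let Pb D : P (b D) = b (P D). Proof. exact: pre_dform_neg_pre. Qed.
Let PP D : P (P D) = P D. Proof. exact: pre_dform_idem. Qed.

(* Locked, as unification would otherwise see through these sums. *)
Fact sop_key : unit. Proof. exact: tt. Qed.
Definition opp_degree D : sop p O := locked_with sop_key (b (e D) - P D).
Definition lowering D : sop p O :=
  locked_with sop_key (e (e (b D)) + 2 *: (e D - e (P D))).
Local Notation h := opp_degree.
Local Notation k := lowering.

Lemma opp_degreeE D : h D = b (e D) - P D.
Proof. by rewrite /h; case: sop_key. Qed.

Lemma loweringE D : k D = e (e (b D)) + 2 *: (e D - e (P D)).
Proof. by rewrite /k; case: sop_key. Qed.

Fact opp_degree_linear : linear h.
Proof.
move=> a D E.
by rewrite !opp_degreeE ad_linear neg_pre_linear pre_dform_linear scalerBr opprD addrACA.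
Qed.
HB.instance Definition _ := GRing.isLinear.Build R (sop p O) (sop p O) _ h opp_degree_linear.

(** The Lie derivatives along [x X] and [x^2 X] are polynomials in [l]; [opp_degree], which is
    [- N], and [lowering] are their constant terms. *)
Lemma slie_vscale D : slie hausdorffM oO (vscale x X) D = l (L D) + h D.
Proof.
rewrite opp_degreeE; apply: sop_eq => w.
rewrite -[LHS]/(x * X (D w) - D (lie_form (vscale x X) w)).
rewrite -[RHS]/(x * (X (D w) - D (lie_form X w)) +
  (- (D (fscale x (lie_form X w)) - x * D (lie_form X w)) - D (dform x X w))).
rewrite (_ : lie_form (vscale x X) w = dform x X w + fscale x (lie_form X w)).
  by rewrite sop_argD; ring.
by rewrite /dform subrK.
Qed.

Lemma slie_vscale2 D : slie hausdorffM oO (vscale (x * x) X) D =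
  l (l (L D)) + 2 *: l (h D) + k D.
Proof.
have E w : lie_form (vscale (x * x) X) w =
    fscale x (dform x X w) + fscale x (dform x X w) + fscale x (fscale x (lie_form X w)).
  have <- : fscale (x * x) (lie_form X w) = fscale x (fscale x (lie_form X w)).
    by apply: form_inj => Ys; rewrite !fscaleE mulrA.
  by rewrite -mulr2n -dform_sqr /dform subrK.
have E1 w : D (lie_form X (fscale x w)) = D w + D (fscale x (lie_form X w)).
  by rewrite lie_form_scale sop_argD (sop_rmul1 _ _ x1).
have E2 w : D (lie_form X (fscale x (fscale x w))) =
    D (fscale x w) + D (fscale x w) + D (fscale x (fscale x (lie_form X w))).
  rewrite lie_form_scale sop_argD (sop_rmul1 _ _ x1) lie_form_scale.
  rewrite (raddfD (fscale x)) /= sop_argD addrA.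
  have -> : fscale x (fscale (X x) w) = fscale (X x) (fscale x w).
    by apply: form_inj => Ys; rewrite !fscaleE mulrCA.
  by rewrite (sop_rmul1 _ _ x1).
rewrite loweringE opp_degreeE; apply: sop_eq => w.
rewrite -[LHS]/(x * x * X (D w) - D (lie_form (vscale (x * x) X) w)).
rewrite -[RHS]/(x * (x * (X (D w) - D (lie_form X w))) +
  2 *: (x * (- (D (fscale x (lie_form X w)) - x * D (lie_form X w)) - D (dform x X w))) +
  ((- D (lie_form X (fscale x (fscale x w))) - x * - D (lie_form X (fscale x w))) -
   x * (- D (lie_form X (fscale x w)) - x * - D (lie_form X w)) +
   2 *: ((D (fscale x w) - x * D w) - (D (dform x X (fscale x w)) - x * D (dform x X w))))).
rewrite E dform_fscale E2 E1; move: (dform x X w) => u; rewrite !sop_argD.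
by rewrite !scaler_nat; ring.
Qed.

Definition casimir D : sop p O := locked_with sop_key (
  L (slie hausdorffM oO (vscale (x * x) X) D) -
  2 *: slie hausdorffM oO (vscale x X) (slie hausdorffM oO (vscale x X) D) +
  slie hausdorffM oO (vscale (x * x) X) (L D)).

Lemma casimir_def D : casimir D = L (slie hausdorffM oO (vscale (x * x) X) D) -
  2 *: slie hausdorffM oO (vscale x X) (slie hausdorffM oO (vscale x X) D) +
  slie hausdorffM oO (vscale (x * x) X) (L D).
Proof. by rewrite /casimir; case: sop_key. Qed.

Fact casimir_linear : linear casimir.
Proof.
move=> a D E; rewrite !casimir_def.
exact: (@sl2_comb_linear _ _ L (slie hausdorffM oO (vscale (x * x) X))
  (slie hausdorffM oO (vscale x X))).
Qed.
HB.instance Definition _ := GRing.isLinear.Build R (sop p O) (sop p O) _ casimir casimir_linear.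

Let casD D E : casimir (D + E) = casimir D + casimir E. Proof. exact: linearD. Qed.
Let casZ a D : casimir (a *: D) = a *: casimir D. Proof. exact: linearZ. Qed.
Let bB D E : b (D - E) = b D - b E. Proof. exact: linearB. Qed.
Let PZ a D : P (a *: D) = a *: P D. Proof. exact: linearZ. Qed.
Let lD D E : l (D + E) = l D + l E. Proof. exact: linearD. Qed.
Let LD D E : L (D + E) = L D + L E. Proof. exact: linearD. Qed.
Let LZ a D : L (a *: D) = a *: L D. Proof. exact: linearZ. Qed.
Let eZ a D : e (a *: D) = a *: e D. Proof. exact: linearZ. Qed.
Let eB D E : e (D - E) = e D - e E. Proof. exact: linearB. Qed.
Let bZ a D : b (a *: D) = a *: b D. Proof. exact: linearZ. Qed.
Let PB D E : P (D - E) = P D - P E. Proof. exact: linearB. Qed.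
Let hD D E : h (D + E) = h D + h E. Proof. exact: linearD. Qed.
Let hB D E : h (D - E) = h D - h E. Proof. exact: linearB. Qed.
Let hZ a D : h (a *: D) = a *: h D. Proof. exact: linearZ. Qed.

Lemma slie_opp_degree D : L (h D) = h (L D).
Proof. by rewrite !opp_degreeE (linearB L) /= Lb Le LP. Qed.

Lemma lmul_opp_degree D : l (h D) = h (l D).
Proof. by rewrite !opp_degreeE (linearB l) /= lmul_neg_pre lmul_ad lmul_pre_dform. Qed.

Lemma pre_dform_opp_degree D : P (h D) = h (P D).
Proof. by rewrite !opp_degreeE PB Pb Pe. Qed.

Lemma slie_lowering D : L (k D) = k (L D).
Proof. by rewrite !loweringE LD LZ (linearB L) /= !Le LP Lb. Qed.

(* The Casimir element of the copy [d/dx, x d/dx, x^2 d/dx] of sl_2, which acts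
   through the degree operator up to a term that lowers the order. *)
Lemma casimirE D : casimir D = 2 *: (h D - h (h D) + k (L D)).
Proof.
rewrite casimir_def !slie_vscale2 !slie_vscale !LD LZ !hD !Ll !lD.
rewrite !slie_opp_degree slie_lowering -!lmul_opp_degree.
by apply: sop_eqz => w z; rewrite !(sopD, sopN, sopZ); ring.
Qed.

Lemma sop_order_opp_degree j D : sop_order j D -> sop_order j (h D).
Proof.
case: j => [->|j oD]; first by rewrite linear0; exact: sop_order0.
rewrite opp_degreeE; apply: sop_orderB; last exact: sop_order_pre_dform.
by apply: sop_order_neg_pre; exact: sop_order_ad.
Qed.

Lemma sop_order_lowering j D : sop_order j.+1 D -> sop_order j (k D).
Proof.
move=> oD; rewrite loweringE; apply: sop_orderD.
  by do 2 apply: sop_order_ad; exact: sop_order_neg_pre.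
apply: sop_orderZ; apply: sop_orderB; apply: sop_order_ad => //.
exact: sop_order_pre_dform.
Qed.

Lemma sop_order_casimir j D : sop_order j D -> sop_order j (casimir D).
Proof.
move=> oD; rewrite casimir_def; apply: sop_orderD; last by do 2 apply: sop_order_slie.
apply: sop_orderB; first by do 2 apply: sop_order_slie.
by apply: sop_orderZ; do 2 apply: sop_order_slie.
Qed.

(** [- b e] has eigenvalues 0, 1, 2, .., so [s - b e] is injective for [s > 0]. Applying [e]
    replaces [D] by [e D] and [s] by [s + 1], at one order less. *)
Lemma sop_order_shift j s D : 0 < s -> sop_order j.+1 D ->
  sop_order j (s *: D - b (e D)) -> sop_order j D.
Proof.
elim: j s D => [|j IHj] s D s0 oD sD; have sn0 : s != 0 by rewrite gt_eqF.
  apply: (sop_orderZK sn0); move: sD.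
  by rewrite (sop_order_ad x oD : e D = 0) linear0 subr0.
have oeD : sop_order j (e D).
  apply: (IHj (s + 1)); [by rewrite addr_gt0|exact: sop_order_ad|].
  have := sop_order_ad x sD; rewrite eB eZ; congr sop_order.
  rewrite (_ : e (b (e D)) = b (e (e D)) - e D); last by rewrite (be (e D)) addrK.
  by apply: sop_eqz => w z; rewrite !(sopD, sopN, sopZ); ring.
apply: (sop_orderZK sn0); rewrite -[s *: D](subrK (b (e D))).
by apply: sop_orderD => //; exact: sop_order_neg_pre.
Qed.

(** On the image of [P] the degree [N] is [1 - b e]. A zero Casimir says that [N (N + 1) D] has
    lower order, hence so does [(1 - b e) (2 - b e) (P D)], and [sop_order_shift] removes both
    factors. *)
Lemma casimir_eq0_order j D : sop_order j.+1 D -> casimir D = 0 -> sop_order j (P D).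
Proof.
move=> oD /eqP; rewrite casimirE scaler_eq0 pnatr_eq0 /= => /eqP c0.
have hh : h (h D) - h D = k (L D).
  by move: c0 => /eqP; rewrite addrC addr_eq0 opprB => /eqP ->.
have oE : sop_order j.+1 (P D) by exact: sop_order_pre_dform.
set E := P D in oE *; set F := E - h E.
have oF : sop_order j.+1 F by apply: sop_orderB => //; exact: sop_order_opp_degree.
have PE : P E = E by exact: PP.
have PF : P F = F by rewrite PB PE pre_dform_opp_degree PE.
have {}oF' : sop_order j F.
  apply: (@sop_order_shift j 1) => //.
  have : sop_order j (P (h (h D) - h D)).
    by rewrite hh; apply: sop_order_pre_dform; apply: sop_order_lowering; exact: sop_order_slie.
  rewrite PB !pre_dform_opp_degree; congr sop_order.
  have hF : h F = b (e F) - F by rewrite opp_degreeE PF.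
  by rewrite scale1r -[RHS]opprB -hF hB opprB.
apply: (@sop_order_shift j 2) => //.
move: oF'; congr sop_order; rewrite /F opp_degreeE PE opprB addrA scaler_nat mulr2n.
by [].
Qed.

(* The components of D are the images under b of those of [e D], and a rest killed by e. *)
Lemma degree_decomposition j D : sop_order j.+1 D ->
  exists F : nat -> sop p O, D = \sum_(t < j.+1) F t /\
    forall t, (t <= j)%N -> sop_order j.+1 (F t) /\ b (e (F t)) = - t%:R *: F t.
Proof.
elim: j D => [|j IHj] D oD.
  exists (fun=> D); split; first by rewrite big_ord1.
  case=> // _; split=> //.
  by rewrite (sop_order_ad x oD : e D = 0) linear0 oppr0 scale0r.
have [F [eDF HF]] := IHj _ (sop_order_ad x oD).
(* The Weyl relation gives [e (b (F t)) = - (t + 1) F t], so [G t] is a preimage of [F t] under [e],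
   of degree [t + 1]. What remains of [D] is killed by [e] and has degree 0. *)
pose G t := - t.+1%:R^-1 *: b (F t).
have oG t : (t <= j)%N -> sop_order j.+2 (G t).
  by move=> /HF[oF _]; apply: sop_orderZ; exact: sop_order_neg_pre.
have eG t : (t <= j)%N -> e (G t) = F t.
  move=> /HF[_ bF]; rewrite /G eZ.
  rewrite (_ : e (b (F t)) = b (e (F t)) - F t); last by rewrite (be (F t)) addrK.
  rewrite bF.
  rewrite (_ : - t%:R *: F t - F t = - t.+1%:R *: F t).
    by rewrite scalerA mulrNN mulVf ?pnatr_eq0// scale1r.
  by rewrite -natr1 opprD scalerDl scaleN1r.
exists (fun t => if t is t'.+1 then G t' else D - \sum_(t < j.+1) G t); split.
  by rewrite big_ord_recl /= subrK.
case=> [_|t tj]; last first.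
  split; first exact: oG.
  rewrite eG// /G scalerA mulrNN mulfV ?pnatr_eq0// scale1r.
  by [].
split; first by apply: sop_orderB => //;
  rewrite (eq_bigr (fun t : 'I_j.+1 => if (t <= j)%N then G t else 0)) => [|t _];
    [apply: sop_order_sum => t; case: ifP => [/oG//|_]; exact: sop_order0|rewrite -ltnS ltn_ord].
rewrite eB (linear_sum e) /= (eq_bigr (fun t : 'I_j.+1 => F t)) => [|t _].
  by rewrite -eDF subrr linear0 oppr0 scale0r.
by apply: eG; rewrite -ltnS.
Qed.

(** To leading order the Casimir is [- 2 a (a + 1)] in degree [a], so this shift annihilates that
    degree up to lower order. *)
Definition casimir_shift (a : nat) D : sop p O :=
  locked_with sop_key (casimir D + (2 * (a%:R * (a%:R + 1))) *: D).

Lemma casimir_shiftE a D : casimir_shift a D = casimir D + (2 * (a%:R * (a%:R + 1))) *: D.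
Proof. by rewrite /casimir_shift; case: sop_key. Qed.

Definition casimir_prod (s : seq nat) D : sop p O := foldr casimir_shift D s.

Lemma casimir_shiftD a D E : casimir_shift a (D + E) = casimir_shift a D + casimir_shift a E.
Proof. by rewrite !casimir_shiftE casD scalerDr addrACA. Qed.

Lemma casimir_shiftZ a c D : casimir_shift a (c *: D) = c *: casimir_shift a D.
Proof. by rewrite !casimir_shiftE casZ scalerDr !scalerA [c * _]mulrC. Qed.

Lemma casimir_prodD s D E : casimir_prod s (D + E) = casimir_prod s D + casimir_prod s E.
Proof. by elim: s => //= a s ->; rewrite casimir_shiftD. Qed.

Lemma casimir_prodZ s c D : casimir_prod s (c *: D) = c *: casimir_prod s D.
Proof. by elim: s => //= a s ->; rewrite casimir_shiftZ. Qed.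

Lemma sop_order_casimir_shift j a D : sop_order j D -> sop_order j (casimir_shift a D).
Proof.
by move=> oD; rewrite casimir_shiftE; apply: sop_orderD;
  [exact: sop_order_casimir|exact: sop_orderZ].
Qed.

Lemma sop_order_casimir_prod j s D : sop_order j D -> sop_order j (casimir_prod s D).
Proof. by move=> oD; elim: s => //= a s; exact: sop_order_casimir_shift. Qed.

Lemma casimir_prod_eigen j s (mu : R) F : sop_order j.+1 F -> h F = - mu *: F ->
  exists2 G, sop_order j G & casimir_prod s F =
    (\prod_(a <- s) (2 * (a%:R * (a%:R + 1) - mu * (mu + 1)))) *: F + G.
Proof.
move=> oF hF; elim: s => [|a s [G oG IHs]] /=.
  by exists 0; [exact: sop_order0|rewrite big_nil scale1r addr0].
rewrite IHs casimir_shiftD casimir_shiftZ big_cons; set c := \prod_(_ <- _) _.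
exists (c *: (2 *: k (L F)) + casimir_shift a G).
  apply: sop_orderD; last exact: sop_order_casimir_shift.
  do 2 apply: sop_orderZ; apply: sop_order_lowering; exact: sop_order_slie.
rewrite addrA; congr (_ + _); rewrite casimir_shiftE casimirE hF hZ hF.
move: (a%:R) c F (k (L F)) {oF hF IHs} => a' {}c {}F K.
apply: sop_eqz => w z.
rewrite -[LHS]/(c * (2 * (- mu * F w z - - mu * (- mu * F w z) + K w z) + 2 * (a' * (a' +
  1)) * F w z)).
by rewrite -[RHS]/(2 * (a' * (a' + 1) - mu * (mu + 1)) * c * F w z + c * (2 * K w z)); ring.
Qed.

(** A component with [- b e = t] splits under [P] into parts of degree [t + 1] and [t]. The flag
    [pi] allows for [P] being nonzero, so all degrees are at most [n + pi] and each is a root of the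
    product. *)
Lemma casimir_prod_lower (pi : bool) (n j : nat) D :
  (pi = false -> forall D, P D = 0) -> (j <= n)%N -> sop_order j.+1 D ->
  sop_order j (casimir_prod (iota 0 (n + pi).+1) D).
Proof.
move=> P0 jn /degree_decomposition[F [-> HF]].
have eig (c : nat) E : (c <= n + pi)%N -> sop_order j.+1 E -> h E = - c%:R *: E ->
    sop_order j (casimir_prod (iota 0 (n + pi).+1) E).
  move=> cn oE hE; have [G oG ->] := casimir_prod_eigen (iota 0 (n + pi).+1) oE hE.
  rewrite (_ : \prod_(_ <- _) _ = 0) ?scale0r ?add0r//.
  apply/eqP; rewrite prodf_seq_eq0; apply/hasP; exists c; first by rewrite mem_iota.
  by rewrite /= subrr mulr0.
have casimir_prod_sum (r : seq 'I_j.+1) : (forall t : 'I_j.+1, sop_order j (casimir_prod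
  (iota 0 (n + pi).+1) (F t))) ->
    sop_order j (casimir_prod (iota 0 (n + pi).+1) (\sum_(t <- r) F t)).
  move=> HFt; elim: r => [|t r IHr].
    by rewrite big_nil; apply: sop_order_casimir_prod; exact: sop_order0.
  by rewrite big_cons casimir_prodD; exact: sop_orderD.
apply: casimir_prod_sum => t; have tj : (t <= j)%N by rewrite -ltnS.
have [oF bF] := HF t tj.
have -> : F t = P (F t) + (F t - P (F t)) by rewrite addrC subrK.
rewrite casimir_prodD; apply: sop_orderD.
  case: pi P0 eig => [_ eig|/(_ erefl) -> _]; last first.
    by apply: sop_order_casimir_prod; exact: sop_order0.
  apply: (eig t.+1); [by rewrite addn1 ltnS (leq_trans tj)|exact: sop_order_pre_dform|].
  rewrite opp_degreeE PP -Pe -Pb bF PZ -natr1 opprD scalerDl scaleN1r.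
  by [].
apply: (eig t); first by rewrite (leq_trans tj)// (leq_trans jn)// leq_addr.
  by apply: sop_orderB => //; exact: sop_order_pre_dform.
rewrite opp_degreeE PB PP subrr subr0 eB bB -Pe -Pb bF PZ.
by rewrite scalerBr.
Qed.

Lemma casimir_prod_nilpotent (pi : bool) (n : nat) D :
  (pi = false -> forall D, P D = 0) -> sop_order n.+1 D ->
  iter n.+1 (casimir_prod (iota 0 (n + pi).+1)) D = 0.
Proof.
move=> P0 oD.
suff H i : (i <= n.+1)%N ->
    sop_order (n.+1 - i) (iter i (casimir_prod (iota 0 (n + pi).+1)) D).
  by have := H n.+1 (leqnn _); rewrite subnn.
elim: i => [|i IHi] ni; first by rewrite subn0.
rewrite iterS; apply: casimir_prod_lower => //; first by rewrite subSS leq_subr.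
by rewrite -subSn//= subSS; apply: IHi; exact: ltnW.
Qed.

End Casimir.
End Order.

(** * The projectors and Casimir operators of a frame *)

Section FrameOperators.
Context {R : realType} {m : nat}.
Variable M : smooth_manifold R m.
Hypothesis hausdorffM : hausdorff_space M.
Variables (U : set M) (x : 'I_m -> Cinf M) (d : 'I_m -> vfield M).
Hypotheses (oU : open U) (frameU : local_frame U x d).
Variable p : nat.
Implicit Types (D : sop p U) (w : form M p).

Local Notation P i := (pre_dform oU (x i) (d i)).

Lemma frame_dual i j z : U z -> d i (x j) z = (i == j)%:R.
Proof. by have [+ _] := frameU; apply. Qed.

Lemma frame_dual1 i z : U z -> d i (x i) z = 1.
Proof. by move=> Uz; rewrite frame_dual// eqxx. Qed.

Lemma frame_dual0 i j z : i != j -> U z -> d i (x j) z = 0.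
Proof. by move=> ij Uz; rewrite frame_dual// (negbTE ij). Qed.

Lemma vbracket_frame i j f z : U z -> vbracket (d i) (d j) f z = 0.
Proof.
move=> Uz; have [_ ->//] := frameU; rewrite big1// => k _.
rewrite vbracketE -[X in X * _]/(d i (d j (x k)) z - d j (d i (x k)) z).
rewrite (vfield_local_cst hausdorffM _ oU (a := (j == k)%:R))//; last exact: frame_dual.
rewrite (vfield_local_cst hausdorffM _ oU (a := (i == k)%:R))//; last exact: frame_dual.
by rewrite subrr mul0r.
Qed.

Lemma form_sum w Ys a (I : Type) (r : seq I) (X : I -> vfield M) :
  w (upd Ys a (\sum_(i <- r) X i)) = \sum_(i <- r) w (upd Ys a (X i)).
Proof.
have w0 : w (upd Ys a 0) = 0.
  have -> : (0 : vfield M) = vscale 0 0 by apply: vfield_inj => f; rewrite vscaleE mul0r.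
  by rewrite form_scale mul0r.
by elim: r => [|i r IHr]; rewrite ?big_nil// !big_cons form_add IHr.
Qed.

Lemma vfield_sumE (I : Type) (r : seq I) (X : I -> vfield M) f :
  (\sum_(i <- r) X i) f = \sum_(i <- r) X i f.
Proof. by apply: (big_morph (fun Y : vfield M => Y f)). Qed.

(** Each slot contributes [w] once, by the expansion of its field in the frame. *)
Lemma sum_dform w : vanish_on U (\sum_i dform (x i) (d i) w - p%:R *: w).
Proof.
move=> Ys z Uz; rewrite formBE.
have -> : (\sum_i dform (x i) (d i) w) Ys =
    \sum_a w (upd Ys a (\sum_i vscale (Ys a (x i)) (d i))).
  rewrite (big_morph (fun v : form M p => v Ys) (id1 := 0) (op1 := +%R))//.
  under eq_bigr do rewrite dformE.
  by rewrite exchange_big; apply: eq_bigr => a _; rewrite form_sum.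
rewrite -[LHS]/((\sum_a w (upd Ys a (\sum_i vscale (Ys a (x i)) (d i)))) z - p%:R * w Ys z).
rewrite Cinf_sumE (eq_bigr (fun=> w Ys z)) => [|a _].
  by rewrite sumr_const card_ord mulr_natl subrr.
rewrite -[in RHS](upd_id Ys a); apply: (form_local_eq hausdorffM _ _ _ oU) => // f y Uy.
rewrite vfield_sumE Cinf_sumE; have [_ ->//] := frameU.
Qed.

Lemma sum_pre_dform D : \sum_i P i D = p%:R *: D.
Proof.
apply: sop_eq => w.
rewrite (big_morph (fun E : sop p U => E w) (id1 := 0) (op1 := +%R))//.
rewrite -[RHS]/(p%:R *: D w).
have DZ a v : D (a *: v) = a *: D v by exact: linearZ.
have /(sop_vanish_eq D) := sum_dform w; rewrite DZ => <-.
by rewrite (linear_sum D) /=.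
Qed.

Lemma pre_dformC i j D : P i (P j D) = P j (P i D).
Proof.
have [->//|ij] := eqVneq i j; apply: sop_eq => w.
rewrite -[LHS]/(D (dform (x j) (d j) (dform (x i) (d i) w))).
rewrite -[RHS]/(D (dform (x i) (d i) (dform (x j) (d j) w))).
apply: sop_vanish_eq; apply: dformC => // z; apply: frame_dual0 => //.
by rewrite eq_sym.
Qed.

(* The commuting projectors P i, i in r, have a sum with eigenvalues at most size r. *)
Lemma sop_order_sum_projectors j (s : R) (r : seq 'I_m) D : (size r)%:R < s ->
  sop_order j (s *: D - \sum_(i <- r) P i D) -> sop_order j D.
Proof.
elim: r s D => [|i r IHr] s D /= rs.
  by rewrite big_nil subr0; apply: sop_orderZK; rewrite gt_eqF.
rewrite big_cons => oD.
(* Applying [P i] to the hypothesis gives the same one for [P i D], with [s - 1] for [s] and without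
   [i]. Knowing this, the term [P i D] can be added back to treat [D]. *)
have oPD : sop_order j (P i D).
  apply: (IHr (s - 1)); first by rewrite ltrBrDr natr1.
  have := sop_order_pre_dform oU (x i) (d i) oD; congr sop_order.
  rewrite (linearB (P i)) (linearD (P i)) (linear_sum (P i)) /=.
  have PZ a E : P i (a *: E) = a *: P i E by exact: linearZ.
  rewrite PZ pre_dform_idem//; last exact: frame_dual1.
  rewrite opprD addrA scalerBl scale1r; congr (_ - _).
  by apply: eq_bigr => k _; rewrite pre_dformC.
apply: (IHr s); first by apply: lt_trans rs; rewrite ltr_nat.
have := sop_orderD oD oPD; congr sop_order.
by rewrite opprD addrA addrAC subrK.
Qed.

(** For [i >= t] the operator [P i D] has lower order. As the [P i] sum to [p], modulo lower order
    [p D] is the sum of the [P i D] with [i < t]; but at most [t < p] commuting projectors cannot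
    add up to [p]. So the order drops until [D = 0]. *)
Lemma casimir_eq0_eq0 (t : nat) D j : (t < p)%N -> sop_order j D ->
  (forall i : 'I_m, (t <= i)%N -> casimir hausdorffM oU (x i) (d i) D = 0) -> D = 0.
Proof.
move=> tp + cD; elim: j D cD => [|j IHj] D cD oD; first exact: oD.
apply: IHj => //.
have oP (i : 'I_m) : (t <= i)%N -> sop_order j (P i D).
  by move=> ti; apply: casimir_eq0_order oD (cD i ti) => z; exact: frame_dual1.
pose r := [seq i : 'I_m <- enum 'I_m | (i < t)%N].
have sr : (size r <= t)%N.
  have := @uniq_leq_size _ (map (@nat_of_ord m) r) (iota 0 t); rewrite size_map size_iota; apply.
    by rewrite (map_inj_uniq (@ord_inj m)); apply: filter_uniq; exact: enum_uniq.
  by move=> _ /mapP[i + ->]; rewrite mem_filter mem_iota => /andP[].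
apply: (@sop_order_sum_projectors j p%:R r).
  by rewrite ltr_nat (leq_ltn_trans sr).
have -> : p%:R *: D - \sum_(i <- r) P i D = \sum_(i < m | (t <= i)%N) P i D.
  rewrite -sum_pre_dform (bigID (fun i : 'I_m => (i < t)%N)) /=.
  have -> : \sum_(i <- r) P i D = \sum_(i < m | (i < t)%N) P i D.
    by rewrite /r big_filter big_enum_cond; apply: eq_bigl.
  rewrite [X in X - _]addrC addrK.
  by apply: eq_bigl => i; rewrite -leqNgt.
elim/big_rec: _ => [|i E ti oE]; first exact: sop_order0.
by apply: sop_orderD => //; exact: oP.
Qed.

End FrameOperators.

(** * Test forms and test operators *)

Section TestForm.
Context {R : realType} {m : nat}.
Variable M : smooth_manifold R m.
Variables (p : nat) (xs : 'I_p -> Cinf M).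

Fact det_form_subproof :
  (fun Ys : 'I_p -> vfield M => \det (\matrix_(i, j) Ys i (xs j))) \in @alt_multilinear R m M p.
Proof.
apply/asboolP; split=> [Ys i f X Y|Ys i j ij Yij]; last first.
  by apply: (determinant_alternate ij) => l; rewrite !mxE Yij.
rewrite -[X in _ = _ + X]mul1r; apply: (determinant_multilinear (i0 := i)).
- by apply/rowP => j; rewrite !mxE /upd eqxx mul1r.
- by apply/matrixP => a b; rewrite !mxE /upd eq_sym (negbTE (neq_lift _ _)).
- by apply/matrixP => a b; rewrite !mxE /upd eq_sym (negbTE (neq_lift _ _)).
Qed.

(** The exterior product of the differentials of the [xs j], used to show that a test operator is
    nonzero. *)
Definition det_form : form M p := MkForm det_form_subproof.

Lemma det_form_dual (Ys : 'I_p -> vfield M) z : (forall i j, Ys i (xs j) z = (i == j)%:R)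
  -> det_form Ys z = 1.
Proof.
move=> dual; rewrite -(@det1 R p) -[LHS]/((\det (\matrix_(i, j) Ys i (xs j))) z).
rewrite /determinant Cinf_sumE; apply: eq_bigr => s _.
have prodE (I : Type) (r : seq I) (F : I -> Cinf M) :
    (\prod_(i <- r) F i) z = \prod_(i <- r) F i z.
  by apply: (big_morph (fun f : Cinf M => f z)).
have signE (b : bool) : ((-1) ^+ b : Cinf M) z = (-1) ^+ b by case: b.
rewrite -[LHS]/(((-1) ^+ perm.odd_perm s : Cinf M) z * (\prod_i (\matrix_(i, j) Ys i (xs
  j)) i (s i)) z).
rewrite signE prodE; congr (_ * _); apply: eq_bigr => i _.
by rewrite !mxE dual.
Qed.

End TestForm.

Section TestOperators.
Context {R : realType} {m : nat}.
Variable M : smooth_manifold R m.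
Hypothesis hausdorffM : hausdorff_space M.
Variables (U : set M) (x : 'I_m -> Cinf M) (d : 'I_m -> vfield M).
Hypotheses (oU : open U) (frameU : local_frame U x d).
Variables (p : nat) (pm : (p <= m)%N) (a : Cinf M) (W : set M).
Hypotheses (oW : open W) (UW : forall z, U z \/ W z) (aW : forall z, W z -> a z = 0).
Implicit Types (w : form M p).

Let ds (s : 'I_p) := d (widen_ord pm s).

Lemma test_mul0 (f : Cinf M) : (forall z, U z -> f z = 0) -> a * f = 0.
Proof.
move=> f0; apply: Cinf_eq => z; rewrite -[LHS]/(a z * f z).
by have [/f0 ->|/aW ->] := UW z; rewrite ?mulr0 ?mul0r.
Qed.

Fact test_op_subproof : (fun w => a * w ds) \in @supported R m M p U.
Proof.
apply/asboolP; split=> [c v w|v v0|f w f0].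
- by rewrite form_lincombE mulrDr Cinf_scaleAr.
- by apply: test_mul0 => z; exact: v0.
- by rewrite mulrA [f * a]mulrC test_mul0// mul0r.
Qed.

(** Evaluation on the first [p] frame fields, cut off by [a]. Its degree in coordinate [i] is 1 for
    [i < p] and 0 otherwise, so as few degrees as possible are nonzero. *)
Definition test_op : sop p U := MkSop test_op_subproof.

Lemma test_op_order : sop_order 1 test_op.
Proof.
move=> f w; rewrite -[LHS]/(a * (f * w ds)).
by rewrite -[RHS]/(f * (a * w ds)) mulrCA.
Qed.

Lemma slie_test_op i w : slie hausdorffM oU (d i) test_op w = d i a * w ds.
Proof.
rewrite -[LHS]/(d i (a * w ds) - a * lie_form (d i) w ds) vfieldM lie_formE mulrBr opprB.
rewrite (_ : a * (\sum_s _) = 0) ?sub0r ?addrK//.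
apply: test_mul0 => z Uz; rewrite Cinf_sumE big1// => s _.
apply: (form_local hausdorffM _ _ _ oU) => // f y Uy.
exact: (vbracket_frame hausdorffM oU frameU).
Qed.

Lemma dform_ds (i : 'I_m) w z : U z ->
  dform (x i) (d i) w ds z = (i < p)%N%:R * w ds z.
Proof.
move=> Uz; rewrite dformE Cinf_sumE.
rewrite (eq_bigr (fun s : 'I_p => (widen_ord pm s == i)%:R * w ds z)) => [|s _].
  rewrite -mulr_suml; congr (_ * _); have [ip|ip] := ltnP i p.
    rewrite (bigD1 (Ordinal ip))//= big1 => [|s si].
      by rewrite (_ : (_ == _)) ?addr0//; apply/eqP/val_inj.
    apply/eqP; rewrite pnatr_eq0 eqb0; apply: contra si => /eqP si.
    by apply/eqP/val_inj; rewrite /= -si.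
  rewrite big1// => s _; apply/eqP; rewrite pnatr_eq0 eqb0.
  by apply: contraTneq ip => <-; rewrite -ltnNge /=.
rewrite form_scale -[LHS]/(ds s (x i) z * w (upd ds s (d i)) z).
rewrite (frame_dual frameU)//; have [<-|_] := eqVneq; last by rewrite !mul0r.
by rewrite -/(ds s) upd_id.
Qed.

Lemma pre_dform_test_op (i : 'I_m) : pre_dform oU (x i) (d i) test_op = (i < p)%N%:R *: test_op.
Proof.
apply: sop_eqz => w z; rewrite -[LHS]/(a z * dform (x i) (d i) w ds z).
rewrite -[RHS]/((i < p)%N%:R * (a z * w ds z)).
by have [Uz|/aW ->] := UW z; [rewrite dform_ds// mulrCA|rewrite !mul0r mulr0].
Qed.

(** Both [e] and [P] in coordinate [i] kill the operator, so its degree is 0; the remaining term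
    [k L] would lower the order below 0 and vanishes exactly, not just to leading order. *)
Lemma casimir_slie_test_op (i j : 'I_m) : (p <= i)%N ->
  casimir hausdorffM oU (x i) (d i) (slie hausdorffM oU (d j) test_op) = 0.
Proof.
move=> pi; set D := slie _ _ _ _.
have oD : sop_order 1 D by apply: sop_order_slie; exact: test_op_order.
have PD : pre_dform oU (x i) (d i) D = 0.
  apply: sop_eqz => w z; rewrite sop0 pre_dformE slie_test_op.
  rewrite -[LHS]/(d j a z * dform (x i) (d i) w ds z).
  have [Uz|Wz] := UW z; first by rewrite dform_ds// ltnNge pi mul0r mulr0.
  by rewrite (vfield_local hausdorffM _ oW aW)// mul0r.
have hD : opp_degree hausdorffM oU (x i) (d i) D = 0.
  by rewrite opp_degreeE PD (sop_order_ad (x i) oD : ad _ _ = 0) linear0 subrr.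
rewrite casimirE; last exact: frame_dual1.
rewrite hD linear0 subrr add0r.
rewrite (_ : lowering _ _ _ _ _ = 0) ?scaler0//.
by apply: (@sop_order_lowering _ _ _ _ _ _ _ _ _ 0); exact: sop_order_slie.
Qed.

Section Powers.
Variables (i : 'I_m).

Local Notation b := (neg_pre hausdorffM oU (d i)).
Local Notation e := (ad (x i)).

(** Of order at most [l] and degree [l + (i < p)] in coordinate [i], the largest degree that this
    order allows. *)
Definition test_power l : sop p U := iter l b test_op.

Lemma test_power_order l : sop_order l.+1 (test_power l).
Proof.
elim: l => [|l IHl]; first exact: test_op_order.
exact: sop_order_neg_pre.
Qed.

Let di1 z : U z -> d i (x i) z = 1. Proof. exact: frame_dual1. Qed.

Lemma neg_pre_ad_test_power l : b (e (test_power l)) = - l%:R *: test_power l.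
Proof.
elim: l => [|l IHl].
  by rewrite (sop_order_ad (x i) test_op_order : ad _ _ = 0) linear0 oppr0 scale0r.
have E : e (b (test_power l)) = b (e (test_power l)) - test_power l.
  by rewrite (neg_pre_ad hausdorffM oU di1) addrK.
have bZ c D : b (c *: D) = c *: b D by exact: linearZ.
rewrite -[test_power l.+1]/(b (test_power l)) E (linearB b) /= IHl bZ.
by rewrite -natr1 opprD scalerDl scaleN1r.
Qed.

(** The constant built here is [(-1)^l l!]. Since [e^l] recovers a multiple of [test_op], an order
    below [l] can be refuted. *)
Lemma iter_ad_test_power l : exists2 c : R, c != 0 &
  iter l e (test_power l) = c *: test_op.
Proof.
elim: l => [|l [c c0 IHl]]; first by exists 1; rewrite ?oner_eq0// scale1r.
exists (- l.+1%:R * c); first by rewrite mulf_neq0// oppr_eq0 pnatr_eq0.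
have E : e (test_power l.+1) = - l.+1%:R *: test_power l.
  have -> : e (test_power l.+1) = b (e (test_power l)) - test_power l.
    by rewrite (neg_pre_ad hausdorffM oU di1) addrK.
  by rewrite neg_pre_ad_test_power -natr1 opprD scalerDl scaleN1r.
have eZ n r D : iter n e (r *: D) = r *: iter n e D.
  by elim: n => //= n ->; exact: linearZ.
by rewrite iterSr E eZ IHl scalerA.
Qed.

Lemma opp_degree_slie_test_power l :
  opp_degree hausdorffM oU (x i) (d i) (slie hausdorffM oU (d i) (test_power l)) =
  - (l + (i < p))%:R *: slie hausdorffM oU (d i) (test_power l).
Proof.
have LZ c D : slie hausdorffM oU (d i) (c *: D) = c *: slie hausdorffM oU (d i) D.
  exact: linearZ.
rewrite -(slie_opp_degree hausdorffM oU di1) -LZ; congr (slie _ _ _ _).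
have Pl : pre_dform oU (x i) (d i) (test_power l) = (i < p)%N%:R *: test_power l.
  elim: l => [|l IHl]; first exact: pre_dform_test_op.
  rewrite -[test_power l.+1]/(b (test_power l)) (pre_dform_neg_pre hausdorffM oU di1) IHl.
  exact: linearZ.
by rewrite opp_degreeE neg_pre_ad_test_power Pl natrD opprD scalerDl scaleNr [- _ *: _ in
  RHS]scaleNr.
Qed.

Lemma iter_ad_slie_test_power l : exists2 c : R, c != 0 &
  iter l e (slie hausdorffM oU (d i) (test_power l)) =
  c *: slie hausdorffM oU (d i) test_op.
Proof.
have [c c0 E] := iter_ad_test_power l; exists c => //.
have Le n D : iter n e (slie hausdorffM oU (d i) D) = slie hausdorffM oU (d i) (iter n e D).
  by elim: n => //= n ->; rewrite (slie_ad hausdorffM oU di1).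
by rewrite Le E; exact: linearZ.
Qed.

End Powers.

End TestOperators.

(** * Lie derivatives along fields that are cut off *)

Section Cutoff.
Context {R : realType} {m : nat}.
Variable M : smooth_manifold R m.
Hypothesis hausdorffM : hausdorff_space M.
Variable p : nat.
Implicit Types (X : vfield M) (w : form M p).

Lemma lie_form_vscale y X w : lie_form (vscale y X) w = dform y X w + fscale y (lie_form X w).
Proof. by rewrite /dform subrK. Qed.

Lemma slie_cutoff (V : set M) (oV : open V) (D : sop p V) (y : Cinf M) X w :
  (forall z, V z -> y z = 1) ->
  vscale y X (D w) - D (lie_form (vscale y X) w) = X (D w) - D (lie_form X w).
Proof.
move=> y1; congr (_ - _).
  rewrite vscaleE; apply/eqP; rewrite -subr_eq0 -[X in _ - X]mul1r -mulrBl; apply/eqP.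
  have y10 z : V z -> (y - 1) z = 0 by move=> Vz; rewrite -[LHS]/(y z - 1) y1// subrr.
  have : X ((y - 1) * D w) = 0 by rewrite sop_mul0// linear0.
  by rewrite vfieldM sop_mul0 ?add0r//; exact: (vfield_local hausdorffM).
rewrite lie_form_vscale sop_argD (sop_rmul1 _ _ y1) sop_vanish ?add0r// => Ys z Vz.
rewrite dformE Cinf_sumE big1// => i _; rewrite form_scale.
rewrite -[LHS]/(Ys i y z * w (upd Ys i X) z).
by rewrite (vfield_local_cst hausdorffM _ oV y1)// mul0r.
Qed.

Lemma lie_op_supported (U W : set M) k (D : diffop M p k) (y : Cinf M) X : open U -> open W ->
  (forall z, U z \/ W z) -> (forall z, W z -> y z = 0) ->
  (lie_op (vscale y X) D : form M p -> Cinf M) \in @supported R m M p U.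
Proof.
move=> oU oW UW yW; have /asboolP[lD oD] := valP D.
have yXW (f : Cinf M) z : W z -> vscale y X f z = 0.
  by move=> Wz; rewrite -[LHS]/(y z * X f z) yW// mul0r.
have yXU (f : Cinf M) : (forall z, U z -> f z = 0) -> vscale y X f = 0.
  move=> f0; apply: Cinf_eq => z; have [Uz|/yXW->//] := UW z.
  exact: (vfield_local hausdorffM _ oU f0).
(* [L_{yX}] involves [y] and its first derivatives; these vanish on [W] as well because [W] is open.
   With the locality of [D], this confines the result to [U] wherever [D] itself lives. *)
have LW w : vanish_on W (lie_form (vscale y X) w).
  move=> Ys z Wz; rewrite lie_form_vscale formD fscaleE dformE.
  rewrite -[LHS]/((\sum_i w (upd Ys i (vscale (Ys i y) X))) z + y z * lie_form X w Ys z).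
  rewrite yW// mul0r addr0 Cinf_sumE big1// => i _; rewrite form_scale.
  rewrite -[LHS]/(Ys i y z * w (upd Ys i X) z).
  by rewrite (vfield_local hausdorffM _ oW yW)// mul0r.
apply/asboolP; split.
- exact: (proj1 (asboolW (valP (lie_op (vscale y X) D)))).
- move=> v v0.
  have L0 : lie_form (vscale y X) v = 0.
    apply: form_inj => Ys; apply: Cinf_eq => z; have [Uz|Wz] := UW z; last exact: LW.
    exact: (vanish_on_lie hausdorffM _ oU v0).
  rewrite -[LHS]/(vscale y X (D v) - D (lie_form (vscale y X) v)) L0 (linear_at0 lD) subr0.
  by apply: yXU => z; exact: (order_le_local hausdorffM oU lD oD v0).
- move=> f w f0; apply: Cinf_eq => z.
  rewrite -[LHS]/(f z * (vscale y X (D w) z - D (lie_form (vscale y X) w) z)).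
  have [Uz|Wz] := UW z; first by rewrite f0// mul0r.
  by rewrite yXW// (order_le_local hausdorffM oW lD oD)// subrr mulr0.
Qed.

End Cutoff.

(** * Equivariant maps *)

Section Equivariant.
Context {R : realType} {m : nat}.
Variable M : smooth_manifold R m.
Hypothesis hausdorffM : hausdorff_space M.

Section Agreement.
Variables (p k : nat) (U : set M).
Hypothesis oU : open U.
Implicit Types (E : diffop M p k) (D : sop p U) (X : vfield M).

(** [T] acts on [diffop], while [ad], [neg_pre] and the degrees live on [sop]; [agree] carries
    identities between the two types for the same underlying map. *)
Definition agree E D := forall w, E w = D w.

Lemma agree_lie E D X : agree E D -> agree (lie_op X E) (slie hausdorffM oU X D).
Proof. by move=> ED w; rewrite slieE -!ED. Qed.

Lemma agreeD E1 E2 D1 D2 : agree E1 D1 -> agree E2 D2 -> agree (E1 + E2) (D1 + D2).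
Proof.
by move=> ED1 ED2 w; rewrite -[LHS]/(E1 w + E2 w) -[RHS]/(D1 w + D2 w) ED1 ED2.
Qed.

Lemma agreeZ c E D : agree E D -> agree (c *: E) (c *: D).
Proof. by move=> ED w; rewrite -[LHS]/(c *: E w) -[RHS]/(c *: D w) ED. Qed.

Lemma agreeB E1 E2 D1 D2 : agree E1 D1 -> agree E2 D2 -> agree (E1 - E2) (D1 - D2).
Proof.
by move=> ED1 ED2 w; rewrite -[LHS]/(E1 w - E2 w) -[RHS]/(D1 w - D2 w) ED1 ED2.
Qed.

Lemma agree_eq0 E D : agree E D -> E = 0 <-> D = 0.
Proof.
move=> ED; split=> [E0|D0].
  by apply: sop_eq => w; rewrite -ED E0.
by apply: val_inj; apply/funext => w; rewrite [LHS]ED D0.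
Qed.

Lemma agree_order E D : agree E D -> sop_order k.+1 D.
Proof.
move=> ED; rewrite /= (_ : sop_val D = diffop_val E); last exact/funext.
by have /asboolP[] := valP E.
Qed.

Lemma exists_agree_sop E : (E : form M p -> Cinf M) \in @supported R m M p U ->
  exists D, agree E D.
Proof. by move=> sE; exists (MkSop sE). Qed.

Lemma exists_agree_diffop D : sop_order k.+1 D -> exists E, agree E D.
Proof.
move=> oD; have dE : (D : form M p -> Cinf M) \in @differential_operator R m M p k.
  by apply/asboolP; split => //; exact: sop_linear.
by exists (MkDiffop dE).
Qed.

End Agreement.

Section LieCasimir.
Variables (x : Cinf M) (X : vfield M).

(** Only [lie_op] enters, so the formula makes sense on operators of arbitrary support and [T]
    commutes with it. *)
Definition lie_casimir p k (E : diffop M p k) : diffop M p k :=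
  lie_op X (lie_op (vscale (x * x) X) E) -
  2 *: lie_op (vscale x X) (lie_op (vscale x X) E) +
  lie_op (vscale (x * x) X) (lie_op X E).

Definition lie_casimir_prod p k (s : seq nat) (E : diffop M p k) : diffop M p k :=
  foldr (fun a E => lie_casimir E + (2 * (a%:R * (a%:R + 1))) *: E) E s.

Lemma agree_casimir p k (U : set M) (oU : open U) (E : diffop M p k) (D : sop p U) :
  agree E D -> agree (lie_casimir E) (casimir hausdorffM oU x X D).
Proof.
move=> ED; rewrite casimir_def; apply: agreeD; last by do 2 apply: agree_lie.
by apply: agreeB; [|apply: agreeZ]; do 2 apply: agree_lie.
Qed.

Lemma agree_casimir_prod p k s (U : set M) (oU : open U) (E : diffop M p k) (D : sop p U) :
  agree E D -> agree (lie_casimir_prod s E) (casimir_prod hausdorffM oU x X s D).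
Proof.
move=> ED; elim: s => //= a s IHs; rewrite casimir_shiftE.
by apply: agreeD; [exact: agree_casimir|exact: agreeZ].
Qed.

Lemma agree_iter_casimir_prod n p k s (U : set M) (oU : open U) (E : diffop M p k) (D : sop p U) :
  agree E D ->
  agree (iter n (@lie_casimir_prod p k s) E) (iter n (casimir_prod hausdorffM oU x X s) D).
Proof. by move=> ED; elim: n => //= n; exact: agree_casimir_prod. Qed.

Variables (p k q l : nat) (T : {linear diffop M p k -> diffop M q l}).
Hypothesis TX : forall (Y : vfield M) (D : diffop M p k), T (lie_op Y D) = lie_op Y (T D).

Lemma equivariant_casimir E : T (lie_casimir E) = lie_casimir (T E).
Proof.
have TZ c D : T (c *: D) = c *: T D by exact: linearZ.
by rewrite /lie_casimir (linearD T) (linearB T) TZ !TX.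
Qed.

Lemma equivariant_casimir_prod s E : T (lie_casimir_prod s E) = lie_casimir_prod s (T E).
Proof.
have TZ c D : T (c *: D) = c *: T D by exact: linearZ.
by elim: s => //= a s IHs; rewrite (linearD T) TZ equivariant_casimir IHs.
Qed.

Lemma equivariant_iter_casimir_prod n s E :
  T (iter n (@lie_casimir_prod p k s) E) = iter n (@lie_casimir_prod q l s) (T E).
Proof. by elim: n => //= n IHn; rewrite equivariant_casimir_prod IHn. Qed.

End LieCasimir.

(** The nested neighbourhoods: [a] is supported in [V], [y] is 1 on [V] and supported in [U], and
    one system of coordinates serves both sets. *)
Lemma exists_test_data (x0 : M) (i0 : 'I_m) :
  exists (U V : set M) (x : 'I_m -> Cinf M) (d : 'I_m -> vfield M) (y a : Cinf M) (W1 W : set M),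
  [/\ open U, open V, open W1 & open W] /\
  [/\ local_frame U x d, local_frame V x d, V x0 & d i0 a x0 = 1] /\
  [/\ (forall z, U z \/ W1 z), (forall z, W1 z -> y z = 0), (forall z, V z -> y z = 1),
      (forall z, V z \/ W z) & (forall z, W z -> a z = 0)].
Proof.
have [U [x [d [oU Ux0 x00 fU]]]] := exists_local_frame hausdorffM x0.
have [y [V [W1 [[oV Vx0] oW1 y1 y0 UW1]]]] := exists_bump_manifold hausdorffM oU Ux0.
have [rho [V' [W [[_ V'x0] oW rho1 rho0 VW]]]] := exists_bump_manifold hausdorffM oV Vx0.
have VU z : V z -> U z.
  by move=> Vz; have [//|/y0 /eqP] := UW1 z; rewrite y1// oner_eq0.
(* Since [x i0] vanishes at [x0] and [rho x0 = 1], the function [rho * x i0] has [d i0]-derivative 1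
   there; this keeps the Lie derivative of the test operator nonzero. *)
exists U, V, x, d, y, (rho * x i0), W1, W; split; first by split.
split; split => //.
- by case: fU => f1 f2; split=> [i j z /VU|X f z /VU]; [exact: f1|exact: f2].
- rewrite vfieldM -[LHS]/(d i0 rho x0 * x i0 x0 + rho x0 * d i0 (x i0) x0).
  by rewrite x00 mulr0 add0r rho1// (frame_dual fU)// eqxx mulr1.
- by move=> z Wz; rewrite -[LHS]/(rho z * x i0 z) rho0// mul0r.
Qed.

Lemma slie_test_op_neq0 (V : set M) (oV : open V) x d (fV : local_frame V x d)
    p (pm : (p <= m)%N) (a : Cinf M) W (oW : open W) (VW : forall z, V z \/ W z)
    (aW : forall z, W z -> a z = 0) i0 x0 : V x0 -> d i0 a x0 = 1 ->
  slie hausdorffM oV (d i0) (test_op d pm VW aW) != 0.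
Proof.
move=> Vx0 da1; apply/eqP => D0.
pose w := det_form (fun s : 'I_p => x (widen_ord pm s)).
have : slie hausdorffM oV (d i0) (test_op d pm VW aW) w x0 = 0 by rewrite D0.
rewrite (slie_test_op hausdorffM oV fV) -[LHS]/(d i0 a x0 * w (fun s => d (widen_ord pm s)) x0).
rewrite da1 mul1r det_form_dual => [/eqP|i j]; first by rewrite oner_eq0.
by rewrite (frame_dual fV).
Qed.

(** The Casimir operators of the coordinates [i >= p] kill a nonzero test operator on [p]-forms.
    They would kill its image on [q]-forms, where [p < q] forces it to be 0. *)
Theorem no_injection_lt_degree (p k q l : nat) (T : {linear diffop M p k -> diffop M q l}) :
  [set: M] !=set0 -> (p < q)%N -> (q <= m)%N -> injective T ->
  ~ (forall (Y : vfield M) (D : diffop M p k), T (lie_op Y D) = lie_op Y (T D)).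
Proof.
move=> [x0 _] pq qm injT TX.
have pm : (p <= m)%N by rewrite (leq_trans (ltnW pq)).
have i0 : 'I_m by exact: Ordinal (leq_trans (leq_ltn_trans (leq0n p) pq) qm).
have [U [V [x [d [y [a [W1 [W [[oU oV oW1 oW] [[fU fV Vx0 da1] [UW1 yW1 yV VW aW]]]]]]]]]]] :=
  exists_test_data x0 i0.
pose F := test_op d pm VW aW.
have [E' EF] := exists_agree_diffop (order_le_leq (leq0n k) (test_op_order d pm VW aW)).
(* As [y] is 1 on [V], where [F] lives, [E0] is [L_{d i0} F]; and its image [L_Y (T E')] is
   supported in [U] whatever [T E'] may be. *)
pose Y := vscale y (d i0); pose E0 := lie_op Y E'.
have ED : agree E0 (slie hausdorffM oV (d i0) F).
  by move=> w; rewrite slieE -(slie_cutoff hausdorffM oV F (d i0) w yV) -!EF.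
have [S ES] := exists_agree_sop
  (lie_op_supported hausdorffM (T E') (d i0) oU oW1 UW1 yW1 : (lie_op Y (T E') : form M q
    -> Cinf M) \in _).
have S0 : S = 0.
  apply: (casimir_eq0_eq0 fU pq (agree_order ES)) => i pi.
  apply/(agree_eq0 (agree_casimir (x i) (d i) oU ES)); rewrite -TX -(equivariant_casimir _ _ TX).
  rewrite (_ : lie_casimir _ _ _ = 0) ?linear0//.
  apply/(agree_eq0 (agree_casimir (x i) (d i) oV ED)).
  exact: casimir_slie_test_op.
have /injT E00 : T E0 = T 0.
  by rewrite linear0 /E0 TX; apply/(agree_eq0 ES).
have /eqP := slie_test_op_neq0 oV fV pm oW VW aW Vx0 da1; apply.
by apply/(agree_eq0 ED).
Qed.

Lemma sop_order_iter_ad p (U : set M) n x (D : sop p U) : sop_order n D -> iter n (ad x) D = 0.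
Proof.
elim: n D => [|n IHn] D oD; first exact: oD.
by rewrite iterSr; apply: IHn; exact: sop_order_ad.
Qed.

Lemma iter_casimir_prod_eigen p (U : set M) (oU : open U) (x : Cinf M) (X : vfield M)
    (x1 : forall z, U z -> X x z = 1) n j s (mu : R) (F : sop p U) :
  sop_order j.+1 F -> opp_degree hausdorffM oU x X F = - mu *: F ->
  exists2 G, sop_order j G & iter n (casimir_prod hausdorffM oU x X s) F =
    (\prod_(a <- s) (2 * (a%:R * (a%:R + 1) - mu * (mu + 1)))) ^+ n *: F + G.
Proof.
move=> oF hF; set c := \prod_(_ <- _) _.
elim: n => [|n [G oG IHn]]; first by exists 0; [exact: sop_order0|rewrite expr0 scale1r addr0].
have [G' oG' EF] := casimir_prod_eigen x1 s oF hF.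
exists (c ^+ n *: G' + casimir_prod hausdorffM oU x X s G).
  by apply: sop_orderD; [exact: sop_orderZ|exact: sop_order_casimir_prod].
rewrite iterS IHn casimir_prodD casimir_prodZ EF -/c.
by rewrite scalerDr scalerA -exprSr addrA.
Qed.

(** A power of the Casimir polynomial with roots at the degrees up to [k + pi] kills the supported
    operators of order [k], but not one of order [l] and degree [l + pi]. *)
Theorem no_injection_gt_order (p k l : nat) (T : {linear diffop M p l -> diffop M p k}) :
  [set: M] !=set0 -> (p <= m)%N -> (0 < m)%N -> (k < l)%N -> injective T ->
  ~ (forall (Y : vfield M) (D : diffop M p l), T (lie_op Y D) = lie_op Y (T D)).
Proof.
move=> [x0 _] pm m0 kl injT TX.
pose i0 := Ordinal m0.
have [U [V [x [d [y [a [W1 [W [[oU oV oW1 oW] [[fU fV Vx0 da1] [UW1 yW1 yV VW aW]]]]]]]]]]] :=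
  exists_test_data x0 i0.
pose F := test_op d pm VW aW.
pose D' := test_power hausdorffM d oV pm VW aW i0 l.
have [E' EF] := exists_agree_diffop (test_power_order hausdorffM d oV pm VW aW i0 l :
  sop_order l.+1 D').
pose Y := vscale y (d i0); pose E0 := lie_op Y E'.
set D0 := slie hausdorffM oV (d i0) D'.
have ED : agree E0 D0.
  by move=> w; rewrite slieE -(slie_cutoff hausdorffM oV D' (d i0) w yV) -!EF.
have [S ES] := exists_agree_sop
  (lie_op_supported hausdorffM (T E') (d i0) oU oW1 UW1 yW1 : (lie_op Y (T E') : form M p
    -> Cinf M) \in _).
pose pi := (i0 < p)%N; pose s := iota 0 (k + pi).+1.
(* [i0] has index 0, so [pi] is false only for [p = 0], where there are no slots to sum over. *)
have P0 : pi = false -> forall D : sop p U, pre_dform oU (x i0) (d i0) D = 0.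
  move=> /negP pi0 D; apply: sop_eq => w; rewrite pre_dformE.
  rewrite (_ : dform _ _ w = 0) ?linear0//; apply: form_inj => Ys.
  rewrite dformE big1// => t _; exfalso; apply: pi0; rewrite /pi /=.
  by apply: leq_ltn_trans (ltn_ord t).
have SU : iter k.+1 (casimir_prod hausdorffM oU (x i0) (d i0) s) S = 0.
  apply: casimir_prod_nilpotent => //; last exact: agree_order ES.
  by move=> z; exact: frame_dual1.
have E0U : iter k.+1 (@lie_casimir_prod (x i0) (d i0) p l s) E0 = 0.
  apply: injT; rewrite linear0 (equivariant_iter_casimir_prod _ _ TX) TX.
  by apply/(agree_eq0 (agree_iter_casimir_prod (x i0) (d i0) k.+1 s oU ES)).
have D0U : iter k.+1 (casimir_prod hausdorffM oV (x i0) (d i0) s) D0 = 0.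
  by apply/(agree_eq0 (agree_iter_casimir_prod (x i0) (d i0) k.+1 s oV ED)).
have d1 z : V z -> d i0 (x i0) z = 1 by exact: frame_dual1.
have oD0 : sop_order l.+1 D0 by exact: agree_order ED.
have [G oG] := iter_casimir_prod_eigen d1 k.+1 s oD0
  (opp_degree_slie_test_power hausdorffM oV fV pm VW aW i0 l).
rewrite D0U; set c := \prod_(_ <- _) _ => cG.
(* The degree [l + pi] exceeds every root [t <= k + pi], and [t (t + 1)] is strictly increasing. *)
have c0 : c != 0.
  rewrite prodf_seq_neq0; apply/allP => t; rewrite mem_iota add0n => tk /=.
  rewrite mulf_neq0 ?pnatr_eq0// subr_eq0 !natr1 -!natrM eqr_nat.
  have tl : (t < l + pi)%N by rewrite (leq_trans tk)// ltn_add2r.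
  by rewrite neq_ltn ltn_mul.
(* [c ^+ k.+1 *: D0 + G = 0] with [G] of order below [l] pushes [D0] below order [l]; yet [e^l D0]
   is a nonzero multiple of [L_{d i0} F]. *)
have oD : sop_order l D0.
  apply: (sop_orderZK (expf_neq0 k.+1 c0)).
  have -> : c ^+ k.+1 *: D0 = - G by apply/eqP; rewrite -addr_eq0 -cG.
  exact: sop_orderN.
have [c' c'0 E] := iter_ad_slie_test_power hausdorffM oV fV pm VW aW i0 l.
have /eqP := slie_test_op_neq0 oV fV pm oW VW aW Vx0 da1; apply.
have := sop_order_iter_ad (x i0) oD; rewrite E => /eqP.
by rewrite scaler_eq0 (negbTE c'0) => /eqP.
Qed.

End Equivariant.

Theorem mainTheorem1 (R : realType) (m : nat) (M : smooth_manifold R m)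
  (hausdorffM : hausdorff_space M) (second_countableM : @second_countable M)
  (connectedM : connected [set: M]) (nonemptyM : [set: M] !=set0)
  (p q k l : nat) (neq : (p, k) <> (q, l))
  (m_ge_sup : (maxn p q <= m)%N) (m_ge_inf : (minn (p + 2) (q + 3) <= m)%N) :
  ~ exists T : {linear diffop M p k -> diffop M q l},
      bijective T /\
      forall (X : vfield M) (D : diffop M p k), T (lie_op X D) = lie_op X (T D).
Proof.
case=> T [[S TK SK] TX].
have lS : linear S := can2_linear TK SK.
pose S' : {linear diffop M q l -> diffop M p k} :=
  HB.pack S (GRing.isLinear.Build _ _ _ _ _ lS).
have SX (X : vfield M) (D : diffop M q l) : S' (lie_op X D) = lie_op X (S' D).
  by apply: (can_inj TK); rewrite TX /= !SK.
have injT : injective T by exact: can_inj TK.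
have injS : injective S' by exact: can_inj SK.
move: m_ge_sup; rewrite geq_max => /andP[pm qm].
have m0 : (0 < m)%N by apply: leq_trans m_ge_inf; rewrite leq_min !addnS.
(* The inverse of [T] is linear and equivariant too, so either direction may be refuted: from the
   smaller form degree to the larger, and for equal degrees from the larger order to the smaller. *)
have [pq|pq|pq] := ltngtP p q.
- exact: (no_injection_lt_degree hausdorffM nonemptyM pq qm injT TX).
- exact: (no_injection_lt_degree hausdorffM nonemptyM pq pm injS SX).
subst q; have [kl|kl|kl] := ltngtP k l.
- exact: (no_injection_gt_order hausdorffM nonemptyM pm m0 kl injS SX).
- exact: (no_injection_gt_order hausdorffM nonemptyM pm m0 kl injT TX).
by apply: neq; rewrite kl.
Qed.
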